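(* Let $L,T,\rho,g,V,\epsilon>0$ and $\Lambda>1$ be fixed real numbers and let $\mu$ be a fixed nonnegative finite Borel measure on $[1,\Lambda]$ (none of these depending on $v$). For each $v>0$ let $f^{\epsilon,v}\in C_V$ be the unique minimizer of $N^{\Lambda,\epsilon}(v,\cdot)$ over $C_V$. Let $\bar v>0$. Then $f^{\epsilon,v}$ converges strongly in $H$ to $f^{\epsilon,\bar v}$ as $v\to\bar v$.
   Context: Let $\Omega=(-L/2,L/2)\times(0,T)$, with points written $(x,z)$. All functions in $H$ are real-valued. Let $$H=\{f\in H^1(\Omega): f(\pm L/2,\cdot)=0 \text{ and } f(\cdot,T)=0 \text{ in the sense of traces}\},$$ a Hilbert space with the $H^1(\Omega)$-norm (no condition is imposed on the side $z=0$). For $f\in H$, $v>0$ and $\lambda\ge 1$, set $$T_f(v,\lambda)=\int_{-L/2}^{L/2}\int_0^T\partial_xf(x,z)\,e^{-\lambda^2vz}e^{-i\lambda vx}\,dz\,dx .$$ Define $$R^\Lambda(v,f)=\frac{4\rho g v}{\pi}\int_{[1,\Lambda]}|T_f(v,\lambda)|^2\,d\mu(\lambda),\qquad N^{\Lambda,\epsilon}(v,f)=R^\Lambda(v,f)+\epsilon\int_\Omega|\nabla f(x,z)|^2\,dx\,dz,$$ and $$C_V=\Big\{f\in H:\ \int_\Omega f\,dx\,dz=V \text{ and } f\ge 0 \text{ a.e. in }\Omega\Big\}.$$ For every $v>0$, the functional $N^{\Lambda,\epsilon}(v,\cdot)$ has exactly one minimizer over $C_V$, denoted $f^{\epsilon,v}$.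 *)

(* Defs.v *)
From mathcomp Require Import all_boot all_order all_algebra.
From mathcomp Require Import all_classical all_reals all_analysis.
From mathcomp Require Import complex.

Set Implicit Arguments.
Unset Strict Implicit.
Unset Printing Implicit Defensive.

Import Order.TTheory GRing.Theory Num.Theory.
Import numFieldNormedType.Exports.

Local Open Scope classical_set_scope.
Local Open Scope ring_scope.
Local Open Scope complex_scope.

Notation leb1 R := (@lebesgue_measure R).
Notation leb2 R := (@lebesgue_measure R \x @lebesgue_measure R)%E.

Section Sobolev.
Context {R : realType}.
Implicit Types (Omega : set (R * R)) (f g phi : R * R -> R) (e : R * R).

Definition dirx : R * R := (1, 0).
Definition dirz : R * R := (0, 1).

Definition C1 phi : Prop :=
  [/\ forall p, differentiable phi p,
      continuous ('D_dirx phi) & continuous ('D_dirz phi)].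

Definition supp phi : set (R * R) := closure [set p | phi p != 0].

(* C^1_c test functions; they give the same weak derivatives as C^oo_c ones. *)
Definition test_function Omega phi : Prop :=
  [/\ C1 phi, compact (supp phi) & supp phi `<=` Omega].

(* Elements of L^2 and H^1 are represented by functions on the whole plane of
   which only the values in Omega matter, up to a null set. *)
Definition L2 Omega f : Prop :=
  measurable_fun (Omega : set (measurableTypeR R * measurableTypeR R)) f /\
  (leb2 R).-integrable Omega (fun p => (f p ^+ 2)%:E).

Definition is_weak_deriv Omega e f g : Prop :=
  L2 Omega g /\
  forall phi, test_function Omega phi ->
    \int[leb2 R]_(p in Omega) (f p * 'D_e phi p) =
    - \int[leb2 R]_(p in Omega) (g p * phi p).

Definition H1 Omega f : Prop :=
  [/\ L2 Omega f, exists g, is_weak_deriv Omega dirx f g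
    & exists g, is_weak_deriv Omega dirz f g].

(* Weak derivatives are unique only up to null sets: pick a representative.
   The value is junk (zero) if f has no square-integrable weak derivative. *)
Definition wderiv Omega e f : R * R -> R :=
  xget (cst 0) [set g | is_weak_deriv Omega e f g].

Definition gradsq Omega f (p : R * R) : R :=
  wderiv Omega dirx f p ^+ 2 + wderiv Omega dirz f p ^+ 2.

(* Meaningful for f in H1 Omega; [Rintegral] is zero on infinite integrals. *)
Definition H1norm Omega f : R :=
  Num.sqrt (\int[leb2 R]_(p in Omega) (f p ^+ 2) +
            \int[leb2 R]_(p in Omega) gradsq Omega f p).

(* [g] is the trace of [f] on the side [gamma @` I] (parametrized by
   arclength): the trace operator is the extension by continuity, from H^1 to
   L^2 of the side, of the restriction of functions that are C^1 up to the
   boundary. *)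
Definition has_trace Omega (gamma : R -> R * R) (I : set R) f (g : R -> R) :
    Prop :=
  exists u : nat -> R * R -> R,
    [/\ forall n, C1 (u n),
        (fun n => H1norm Omega (u n \- f)) @ \oo --> (0 : R)
      & (fun n => (\int[leb1 R]_(t in I) ((u n (gamma t) - g t) ^+ 2)%:E)%E)
          @ \oo --> (0 : \bar R)].

End Sobolev.

Section ComplexIntegral.
Context {R : realType}.

Definition expi (t : R) : R[i] := cos t +i* sin t.

Definition cintegral2 (D : set (R * R)) (F : R * R -> R[i]) : R[i] :=
  (\int[leb2 R]_(p in D) complex.Re (F p)) +i*
  (\int[leb2 R]_(p in D) complex.Im (F p)).

End ComplexIntegral.

Section WaveResistance.
Context {R : realType}.
Implicit Types (L T rho grav V eps Lam v lam : R) (f : R * R -> R).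

Definition rect L T : set (R * R) :=
  [set p | - (L / 2) < p.1 < L / 2 /\ 0 < p.2 < T].

Definition Hspace L T f : Prop :=
  [/\ H1 (rect L T) f,
      has_trace (rect L T) (fun z => (- (L / 2), z)) `]0, T[ f (cst 0),
      has_trace (rect L T) (fun z => (L / 2, z)) `]0, T[ f (cst 0)
    & has_trace (rect L T) (fun x => (x, T)) `]- (L / 2), (L / 2)[ f (cst 0)].

Definition Tf L T f v lam : R[i] :=
  cintegral2 (rect L T) (fun p =>
    (wderiv (rect L T) dirx f p)%:C * (expR (- (lam ^+ 2 * v * p.2)))%:C *
    expi (- (lam * v * p.1))).

Definition Rres L T rho grav Lam
    (mu : {finite_measure set (measurableTypeR R) -> \bar R}) v f : R :=
  4 * rho * grav * v / pi *
  \int[mu]_(lam in `[1, Lam])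
    (ComplexField.Normc.normc (Tf L T f v lam) ^+ 2).

Definition Nfun L T rho grav eps Lam
    (mu : {finite_measure set (measurableTypeR R) -> \bar R}) v f : R :=
  Rres L T rho grav Lam mu v f +
  eps * \int[leb2 R]_(p in rect L T) gradsq (rect L T) f p.

Definition CV L T V : set (R * R -> R) :=
  [set f | [/\ Hspace L T f, \int[leb2 R]_(p in rect L T) f p = V
             & {ae leb2 R, forall p, rect L T p -> 0 <= f p}]].

Definition is_minimizer (A : set (R * R -> R)) (J : (R * R -> R) -> R) f :
    Prop :=
  A f /\ forall h, A h -> J f <= J h.

(* Uniqueness of the minimizer as an element of H, that is, up to equality
   almost everywhere in the rectangle. *)
Definition is_unique_minimizer L T (A : set (R * R -> R))
    (J : (R * R -> R) -> R) f : Prop :=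
  is_minimizer A J f /\
  forall h, is_minimizer A J h ->
    {ae leb2 R, forall p, rect L T p -> h p = f p}.

End WaveResistance.

(* Main.v *)
Require Import Defs.
From mathcomp Require Import all_boot all_order all_algebra.
From mathcomp Require Import all_classical all_reals all_analysis.
From mathcomp Require Import measurable_realfun complex ring lra.
Set Implicit Arguments.
Unset Strict Implicit.
Unset Printing Implicit Defensive.
Import Order.TTheory GRing.Theory Num.Theory.
Import numFieldNormedType.Exports.
Local Open Scope classical_set_scope.
Local Open Scope ring_scope.

(* The functional N(v, .) is a nonnegative quadratic form on a convex set, so
   no compactness is needed.  With f = f^v and g = f^vbar, the parallelogram
   identity at the admissible midpoint (f + g) / 2 gives
     eps |grad (f - g)|^2 <= N(v, f - g) <= 2 (N(v, g) - N(v, f)),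
   and N(vbar, g) <= N(vbar, f) bounds the right-hand side by twice
     |R(v, g) - R(vbar, g)| + |R(v, f) - R(vbar, f)|.
   The kernel exp(- lambda^2 v z) exp(- i lambda v x) is Lipschitz in v
   uniformly on the rectangle, so each term is O(|v - vbar|); f^v stays bounded
   since eps |grad f^v|^2 <= N(v, f^v) <= N(v, g).  The Poincare inequality
   concludes; it comes from integrating d/dx [(x - L/2) u^2] for C^1 functions
   u.  Linearity of the selected weak derivatives rests on the fundamental
   lemma of the calculus of variations. *)

(** [wderiv] is a representative picked by choice, so it is linear in the function only almost
    everywhere; linearity becomes exact after integration. Hence each quadratic functional Q, with
    polar form B, is expanded on [lin a f b g] as a^2 Q(f) + 2ab B(f, g) + b^2 Q(g), and
    inequalities are read off from Q >= 0 at suitable a and b rather than from Cauchy-Schwarz. The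
    same expansion serves the midpoint (1/2, 1/2) and the difference (1, -1). Zero traces are
    defined through C^1 approximations that need not vanish on the side, so the Poincare inequality
    for C^1 functions carries a boundary term, which tends to 0 along the approximation. The
    Lipschitz constant of R in v is written with the fixed speed vbar and the squared L^1 norm of
    the x-derivative, a quantity that the energy controls. The outcome is quantitative: for |v -
    vbar| <= 1 the squared H^1 distance is at most a constant times |v - vbar|. *)

Section C1Calculus.
Context {R : realType}.
Implicit Types (F G : R * R -> R) (p e : R * R).

(** * Calculus of C^1 functions on the plane *)

Lemma C1_continuous F : C1 F -> continuous F.
Proof. by move=> [dF _ _] p; exact: differentiable_continuous. Qed.

Lemma C1_derivable F p e : C1 F -> derivable F p e.
Proof. by move=> [dF _ _]; exact: diff_derivable. Qed.

Lemma C1D F G : C1 F -> C1 G -> C1 (F \+ G).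
Proof.
move=> CF CG.
have D e : 'D_e (F \+ G) = 'D_e F \+ 'D_e G.
  by apply/funext => p; rewrite deriveD //; exact: C1_derivable.
move: CF CG => [dF Fx Fz] [dG Gx Gz]; split; [|rewrite D|rewrite D].
- by move=> p; exact: differentiableD.
- by move=> p; apply: continuousD; [exact: Fx|exact: Gx].
- by move=> p; apply: continuousD; [exact: Fz|exact: Gz].
Qed.

Lemma C1_cst (c : R) : C1 (cst c : R * R -> R).
Proof.
have D e : 'D_e (cst c : R * R -> R) = cst 0.
  by apply/funext => p; rewrite derive_cst.
split; rewrite ?D; [|exact: cst_continuous..].
by move=> p; have := @differentiable_cst R _ _ c p.
Qed.

Lemma derive_C1M F G e : C1 F -> C1 G ->
  'D_e (F \* G) = F \* 'D_e G \+ G \* 'D_e F.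
Proof.
by move=> CF CG; apply/funext => p; rewrite deriveM //; exact: C1_derivable.
Qed.

Lemma C1M F G : C1 F -> C1 G -> C1 (F \* G).
Proof.
move=> CF CG; have cF := C1_continuous CF; have cG := C1_continuous CG.
have D e := derive_C1M e CF CG.
move: CF CG => [dF Fx Fz] [dG Gx Gz]; split; [|rewrite D|rewrite D].
- by move=> p; exact: differentiableM.
- by move=> p; apply: (@continuousD _ R); apply: continuousM => //;
    [exact: cF|exact: Gx|exact: cG|exact: Fx].
- by move=> p; apply: (@continuousD _ R); apply: continuousM => //;
    [exact: cF|exact: Gz|exact: cG|exact: Fz].
Qed.

Lemma C1Z (c : R) F : C1 F -> C1 (fun p => c * F p).
Proof. by move=> CF; exact: (C1M (C1_cst c) CF). Qed.

Lemma C1B F G : C1 F -> C1 G -> C1 (F \- G).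
Proof.
move=> CF CG; rewrite (_ : F \- G = F \+ (fun p => -1 * G p)).
  exact/C1D/C1Z.
by apply/funext => p /=; rewrite mulN1r.
Qed.

Lemma C1_comp (h dh : R -> R) F : (forall y : R, is_derive y 1 h (dh y)) ->
  continuous dh -> C1 F -> C1 (h \o F).
Proof.
move=> hd cdh CF; have cF := C1_continuous CF.
have dh' y : differentiable h y by apply/derivable1_diffP.
have D e : 'D_e (h \o F) = (fun p => 'D_e F p * dh (F p)).
  apply/funext => p; case: CF => [dF _ _].
  rewrite deriveE; last exact: differentiable_comp.
  rewrite diff_comp //= -(deriveE _ (dF p)) deriv1E ?derive1E; last by case: (hd (F p)).
  by rewrite (@derive_val _ _ _ _ _ _ _ (hd (F p))).
move: CF => [dF Fx Fz]; split; [|rewrite D|rewrite D].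
- by move=> p; exact: differentiable_comp.
- move=> p; apply: (@continuousM _ _ ('D_dirx F) (dh \o F)); first exact: Fx.
  by apply: continuous_comp; [exact: cF|exact: cdh].
- move=> p; apply: (@continuousM _ _ ('D_dirz F) (dh \o F)); first exact: Fz.
  by apply: continuous_comp; [exact: cF|exact: cdh].
Qed.

Lemma derive_fst e : 'D_e (fst : R * R -> R) = cst e.1.
Proof.
have dl : forall p, differentiable (fst : R * R -> R) p.
  by move=> p; apply: linear_differentiable => q; exact: cvg_fst.
apply/funext => p; rewrite deriveE //.
by rewrite (diff_lin _) //= => q; exact: cvg_fst.
Qed.

Lemma derive_snd e : 'D_e (snd : R * R -> R) = cst e.2.
Proof.
have dl : forall p, differentiable (snd : R * R -> R) p.
  by move=> p; apply: linear_differentiable => q; exact: cvg_snd.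
apply/funext => p; rewrite deriveE //.
by rewrite (diff_lin _) //= => q; exact: cvg_snd.
Qed.

Lemma C1_fst : C1 (fst : R * R -> R).
Proof.
split; rewrite ?derive_fst; [|exact: cst_continuous..].
by move=> p; apply: linear_differentiable => q; exact: cvg_fst.
Qed.

Lemma C1_snd : C1 (snd : R * R -> R).
Proof.
split; rewrite ?derive_snd; [|exact: cst_continuous..].
by move=> p; apply: linear_differentiable => q; exact: cvg_snd.
Qed.

(** Passes from directional derivatives to one-variable ones, as the fundamental theorem of calculus
    on slices requires; the two difference quotients are the same function of [h]. *)
Lemma is_derive_section_x F (x z : R) : C1 F ->
  is_derive x 1 (fun t => F (t, z)) ('D_dirx F (x, z)).
Proof.
move=> CF; have dF := @C1_derivable F (x, z) dirx CF.
have E : (fun h : R => h^-1 *: (F (h *: 1 + x, z) - F (x, z))) =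
   (fun h : R => h^-1 *: (F (h *: (1, 0) + (x, z)) - F (x, z))).
  apply/funext => h; congr (_ *: (F _ - _)).
  by congr pair; rewrite /= scaler0 add0r.
split.
  by move: dF; rewrite /derivable /= -E.
by rewrite /derive /= E.
Qed.

Lemma is_derive_section_z F (x z : R) : C1 F ->
  is_derive z 1 (fun t => F (x, t)) ('D_dirz F (x, z)).
Proof.
move=> CF; have dF := @C1_derivable F (x, z) dirz CF.
have E : (fun h : R => h^-1 *: (F (x, h *: 1 + z) - F (x, z))) =
   (fun h : R => h^-1 *: (F (h *: (0, 1) + (x, z)) - F (x, z))).
  apply/funext => h; congr (_ *: (F _ - _)).
  by congr pair; rewrite /= scaler0 add0r.
split.
  by move: dF; rewrite /derivable /= -E.
by rewrite /derive /= E.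
Qed.

End C1Calculus.

(** * Measurability of continuous functions on the plane *)

Section PlaneMeasurability.
Context {R : realType}.
Notation MR := (measurableTypeR R).

Lemma open_measurable_plane (U : set (R * R)) : open U ->
  measurable (U : set (MR * MR)).
Proof.
move=> oU.
pose rec (q : (rat * rat) * (rat * rat)) : set (MR * MR) :=
  `]ratr q.1.1, ratr q.1.2[%classic `*` `]ratr q.2.1, ratr q.2.2[%classic.
(* An open set is the union of the rational boxes that it contains. Boxes not inside [U] are
   replaced by the empty set, so the union runs over a countable type. *)
rewrite (_ : U = \bigcup_q (if `[< rec q `<=` U >] then rec q else set0)).
  apply: countable_bigcupT_measurable => // q; case: ifP => // _.
  by apply: measurableX; exact: measurable_itv.
apply/seteqP; split => [[x z] Uxz|p [q _]]; last first.
  by case: asboolP => // recU /recU.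
have /nbhs_ballP[e /= e0 eU] : nbhs (x, z) U by exact: open_nbhs_nbhs.
have eltl (y : R) : y - e < y by lra.
have eltr (y : R) : y < y + e by lra.
have [a1 /[!in_itv]/= /andP[a1l a1r]] := rat_in_itvoo (eltl x).
have [a2 /[!in_itv]/= /andP[a2l a2r]] := rat_in_itvoo (eltr x).
have [b1 /[!in_itv]/= /andP[b1l b1r]] := rat_in_itvoo (eltl z).
have [b2 /[!in_itv]/= /andP[b2l b2r]] := rat_in_itvoo (eltr z).
exists ((a1, a2), (b1, b2)); rewrite // asboolT; first by split; rewrite /= in_itv /=; apply/andP.
move=> [s t] /= [] /=; rewrite !in_itv /= => /andP[s1 s2] /andP[t1 t2].
by apply: eU; split; rewrite /ball /= ltr_norml; lra.
Qed.

Lemma continuous_measurable_plane (F : R * R -> R) (D : set (MR * MR)) :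
  measurable D -> continuous F -> measurable_fun D (F : MR * MR -> MR).
Proof.
move=> mD cF; apply: (measurable_funS measurableT) => //.
apply: (measurability _ (measurable_realfun.RGenOpens.measurableE R)).
move=> _ [_ [a [b ->]] <-]; apply: measurableI => //.
apply: open_measurable_plane.
by move/continuousP : cF; apply; exact: interval_open.
Qed.

End PlaneMeasurability.

(** * Integrability from squares on a set of finite measure *)

Section SquareIntegrable.
Context d (X : measurableType d) (R : realType).
Variables (mu : {measure set X -> \bar R}) (D : set X).
Hypothesis mD : measurable D.
Implicit Types (f g : X -> R).
Notation intg f := (mu.-integrable D (EFin \o f)).

Lemma measurable_integrable f : intg f -> measurable_fun D f.
Proof. by move=> /(measurable_int mu) /measurable_EFinP. Qed.

Lemma le_integrable_real f g : measurable_fun D f -> intg g ->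
  (forall x, D x -> `|f x| <= g x) -> intg f.
Proof.
move=> mf ig fg; apply: (le_integrable mD _ _ ig).
  exact/measurable_EFinP.
move=> x Dx /=; rewrite lee_fin (le_trans (fg x Dx))//; exact: ler_norm.
Qed.

Lemma integrable_realD f g : intg f -> intg g -> intg (fun x => f x + g x).
Proof. by move=> fi gi; have := integrableD mD fi gi. Qed.

Lemma integrable_realB f g : intg f -> intg g -> intg (fun x => f x - g x).
Proof. by move=> fi gi; have := integrableB mD fi gi. Qed.

Lemma integrable_realZ (k : R) f : intg f -> intg (fun x => k * f x).
Proof. by move=> fi; have := integrableZl mD k fi. Qed.

(** Dominated by f^2 + g^2, since 2|f||g| <= f^2 + g^2. *)
Lemma integrable_mul f g : measurable_fun D f -> measurable_fun D g ->
  intg (fun x => f x ^+ 2) -> intg (fun x => g x ^+ 2) ->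
  intg (fun x => f x * g x).
Proof.
move=> mf mg fi gi; apply: (le_integrable_real _ (integrable_realD fi gi)).
  exact: measurable_funM.
move=> x _; rewrite normrM -(real_normK (num_real (f x))) -(real_normK (num_real (g x))).
have := sqr_ge0 (`|f x| - `|g x|); have := normr_ge0 (f x); have := normr_ge0 (g x).
nra.
Qed.

Lemma sqr_integrableD f g : measurable_fun D f -> measurable_fun D g ->
  intg (fun x => f x ^+ 2) -> intg (fun x => g x ^+ 2) ->
  intg (fun x => (f x + g x) ^+ 2).
Proof.
move=> mf mg fi gi.
apply: (@le_integrable_real _ (fun x => 2 * f x ^+ 2 + 2 * g x ^+ 2)).
- by apply: measurable_funX; exact: measurable_funD.
- by apply: integrable_realD; exact: integrable_realZ.
- move=> x _; rewrite ger0_norm ?sqr_ge0//.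
  by have := sqr_ge0 (f x - g x); nra.
Qed.

Lemma sqr_integrableZ (k : R) f : intg (fun x => f x ^+ 2) ->
  intg (fun x => (k * f x) ^+ 2).
Proof.
move=> fi; under [X in mu.-integrable D X]eq_fun do rewrite /= exprMn.
exact: integrable_realZ.
Qed.

Hypothesis Dfin : (mu D < +oo)%E.

Lemma integrable_cst (k : R) : intg (cst k).
Proof.
apply: measurable_bounded_integrable => //; exact: bounded_cst.
Qed.

(** Dominated by 1 + f^2, where the constant 1 is integrable because [D] has finite measure. *)
Lemma sqr_integrable_integrable f : measurable_fun D f ->
  intg (fun x => f x ^+ 2) -> intg f.
Proof.
move=> mf fi.
apply: (@le_integrable_real _ (fun x => 1 + f x ^+ 2)) => //.
  by apply: integrable_realD => //; exact: integrable_cst.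
move=> x _; rewrite -(real_normK (num_real (f x))).
by have := sqr_ge0 (`|f x| - 1); have := normr_ge0 (f x); nra.
Qed.

Lemma integrable_mulr_bounded f g (M : R) : intg f -> measurable_fun D g ->
  (forall x, D x -> `|g x| <= M) -> intg (fun x => f x * g x).
Proof.
move=> fi mg gM.
apply: (@le_integrable_real _ (fun x => `|M| * `|f x|)).
- by apply: measurable_funM => //; exact: measurable_integrable.
- apply: integrable_realZ; exact: integrable_norm.
- move=> x Dx; rewrite normrM mulrC ler_wpM2r// (le_trans (gM x Dx))//.
  exact: ler_norm.
Qed.

Lemma Rintegral_le_abs f g : intg f -> intg g ->
  (forall x, D x -> `|f x| <= g x) ->
  `|\int[mu]_(x in D) f x| <= \int[mu]_(x in D) g x.
Proof.
move=> fi gi fg; apply: (le_trans (le_normr_Rintegral mD fi)).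
by apply: le_Rintegral => //; exact: (integrable_norm fi).
Qed.

Lemma ae_eq_Rintegral f g : intg f -> intg g ->
  {ae mu, forall x, D x -> f x = g x} ->
  \int[mu]_(x in D) f x = \int[mu]_(x in D) g x.
Proof.
move=> fi gi fg; rewrite /Rintegral; congr fine.
apply: ae_eq_integral => //; [exact: measurable_int fi|exact: measurable_int gi|].
by apply: filterS fg => x /= + Dx => /(_ Dx) ->.
Qed.

End SquareIntegrable.

(** * Fubini on product sets *)

Section PlaneIntegration.
Context {R : realType}.
Notation MR := (measurableTypeR R).

(** Fubini on the whole plane is applied to the extension of [F] by zero; the inner integral then
    vanishes for [x] outside [A]. *)
Lemma integral_setX (A B : set MR) (F : R * R -> R) :
  measurable A -> measurable B ->
  (leb2 R).-integrable (A `*` B) (EFin \o F) ->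
  (\int[leb2 R]_(p in A `*` B) (F p)%:E =
   \int[leb1 R]_(x in A) \int[leb1 R]_(z in B) (F (x, z))%:E)%E.
Proof.
move=> mA mB Fi.
rewrite integral_mkcond -integral12_prod_meas1; last first.
  apply/integrable_restrict => //; first exact: measurableX.
  by rewrite setTI.
rewrite [RHS]integral_mkcond; apply: eq_integral => x _.
rewrite /fubini_F patchE; case: ifPn => xA.
  rewrite [RHS]integral_mkcond; apply: eq_integral => z _.
  by rewrite !patchE in_setX xA.
rewrite integral0_eq// => z _.
by rewrite patchE in_setX (negbTE xA).
Qed.

Lemma integral_setX_sym (A B : set MR) (F : R * R -> R) :
  measurable A -> measurable B ->
  (leb2 R).-integrable (A `*` B) (EFin \o F) ->
  (\int[leb2 R]_(p in A `*` B) (F p)%:E =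
   \int[leb1 R]_(z in B) \int[leb1 R]_(x in A) (F (x, z))%:E)%E.
Proof.
move=> mA mB Fi.
rewrite integral_mkcond -integral21_prod_meas1; last first.
  apply/integrable_restrict => //; first exact: measurableX.
  by rewrite setTI.
rewrite [RHS]integral_mkcond; apply: eq_integral => z _.
rewrite /fubini_G patchE; case: ifPn => zB.
  rewrite [RHS]integral_mkcond; apply: eq_integral => x _.
  by rewrite !patchE in_setX zB andbT.
rewrite integral0_eq// => x _.
by rewrite patchE in_setX (negbTE zB) andbF.
Qed.

End PlaneIntegration.

(** * The rectangle and the divergence formulas *)

Section Rectangle.
Context {R : realType}.
Notation MR := (measurableTypeR R).
Variables (L T : R).
Hypotheses (L0 : 0 < L) (T0 : 0 < T).
Notation Om := (rect L T : set (MR * MR)).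
Notation intg F := ((leb2 R).-integrable Om (EFin \o F)).
Implicit Types (F G : R * R -> R).

Lemma rectE : Om = `]- (L / 2), L / 2[%classic `*` `]0, T[%classic.
Proof. by apply/seteqP; split => -[x z] /=; rewrite !in_itv. Qed.

Lemma measurable_rect : measurable Om.
Proof. by rewrite rectE; apply: measurableX; exact: measurable_itv. Qed.

Lemma leb2_rect : leb2 R Om = (L * T)%:E.
Proof.
rewrite rectE product_measure1E; [|exact: measurable_itv..].
rewrite [X in (X * _)%E](_ : _ = L%:E); last first.
  by rewrite /= lebesgue_measure_itv /= lte_fin ifT; [rewrite -EFinD; congr EFin; field|have := L0; lra].
by rewrite /= lebesgue_measure_itv /= lte_fin T0 -EFinD subr0 -EFinM.
Qed.

Lemma leb2_rect_fin : (leb2 R Om < +oo)%E.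
Proof. by rewrite leb2_rect ltry. Qed.

Lemma continuous_bounded_rect F : continuous F ->
  exists M, forall p, Om p -> `|F p| <= M.
Proof.
move=> cF.
have cK : compact (`[- (L / 2), L / 2]%classic `*` `[0, T]%classic : set (R * R)).
  by apply: compact_setX; exact: segment_compact.
have cF' : {within (`[- (L / 2), L / 2]%classic `*` `[0, T]%classic : set (R * R)), continuous F}.
  exact: continuous_subspaceT.
have [M [_ HM]] := compact_bounded (continuous_compact cF' cK).
(* [HM] gives a bound by every number strictly greater than [M], hence the witness [M + 1]. *)
exists (M + 1) => p [p1 p2]; apply: HM; first by rewrite ltrDl.
exists p => //; split; rewrite /= in_itv /=; lra.
Qed.

Lemma continuous_integrable F : continuous F -> intg F.
Proof.
move=> cF; have [M FM] := continuous_bounded_rect cF.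
apply: (le_integrable_real measurable_rect _ (integrable_cst measurable_rect leb2_rect_fin M)) => //.
by apply: continuous_measurable_plane => //; exact: measurable_rect.
Qed.

Lemma integral_EFin_Rintegral (D : set MR) (f : R -> R) :
  measurable D -> (leb1 R).-integrable D (EFin \o f) ->
  (\int[leb1 R]_(x in D) (f x)%:E = (\int[leb1 R]_(x in D) f x)%:E)%E.
Proof. by move=> mD fi; rewrite /Rintegral fineK//; exact: integrable_fin_num. Qed.

Lemma integral_derive_itvoo (f df : R -> R) (a b : R) : a < b -> continuous df ->
  (forall x : R, is_derive x 1 f (df x)) ->
  (\int[leb1 R]_(x in `]a, b[) (df x)%:E = (f b - f a)%:E)%E.
Proof.
move=> ab cdf fdf.
have cf : continuous f.
  by move=> x; apply: differentiable_continuous; apply/derivable1_diffP.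
rewrite -(@integral_itv_bndoo R a b (EFin \o df) true false); last first.
  apply/measurable_EFinP; apply: measurable_funTS.
  exact: continuous_measurable_fun.
rewrite (@continuous_FTC2 R df f a b) //.
- exact: continuous_subspaceT.
- split => //.
  + by apply: cvg_at_right_filter; exact: cf.
  + by apply: cvg_at_left_filter; exact: cf.
- by move=> x _; rewrite derive1E; have [_ ->] := fdf x.
Qed.

Lemma continuous_pairl (z : R) : continuous (fun x : R => (x, z)).
Proof.
by move=> x; apply: (@cvg_pair _ _ _ _ (nbhs x) (nbhs z));
  [exact: cvg_id|exact: cvg_cst].
Qed.

Lemma continuous_pairr (x : R) : continuous (fun z : R => (x, z)).
Proof.
by move=> z; apply: (@cvg_pair _ _ _ _ (nbhs x) (nbhs z));
  [exact: cvg_cst|exact: cvg_id].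
Qed.

(** Fubini with [x] as the inner variable, then the fundamental theorem of calculus on each slice of
    constant [z]. *)
Lemma divergence_x F : C1 F ->
  \int[leb2 R]_(p in Om) 'D_dirx F p =
  \int[leb1 R]_(z in `]0, T[) (F (L / 2, z) - F (- (L / 2), z)).
Proof.
move=> CF; rewrite /Rintegral; congr fine.
have [_ cx _] := CF.
have := continuous_integrable cx; rewrite rectE => ix.
rewrite integral_setX_sym //; [|exact: measurable_itv..].
apply: eq_integral => z _.
have ab : - (L / 2) < L / 2 by have := L0; lra.
apply: (@integral_derive_itvoo (fun x => F (x, z)) (fun x => 'D_dirx F (x, z))) => //.
- move=> x; apply: (@continuous_comp _ _ _ (fun x => (x, z)) ('D_dirx F)).
    exact: continuous_pairl.
  exact: cx.
- by move=> x; exact: is_derive_section_x.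
Qed.

Lemma divergence_z F : C1 F ->
  \int[leb2 R]_(p in Om) 'D_dirz F p =
  \int[leb1 R]_(x in `]- (L / 2), L / 2[) (F (x, T) - F (x, 0)).
Proof.
move=> CF; rewrite /Rintegral; congr fine.
have [_ _ cz] := CF.
have := continuous_integrable cz; rewrite rectE => iz.
rewrite integral_setX //; [|exact: measurable_itv..].
apply: eq_integral => x _.
apply: (@integral_derive_itvoo (fun z => F (x, z)) (fun z => 'D_dirz F (x, z))) => //.
- move=> z; apply: (@continuous_comp _ _ _ (fun z => (x, z)) ('D_dirz F)).
    exact: continuous_pairr.
  exact: cz.
- by move=> z; exact: is_derive_section_z.
Qed.

End Rectangle.

(** * Explicit C^1 bump functions *)

Section BumpFunctions.
Context {R : realType}.
Implicit Types (a b c d x y : R).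

(** The squared positive part is C^1 and vanishes on the negative half-line. This regularity is
    enough, as test functions are only asked to be C^1. *)
Definition pos_sqr y : R := Num.max 0 y ^+ 2.

Lemma is_derive_pos_sqr y : is_derive y 1 pos_sqr (2 * Num.max 0 y).
Proof.
have key : (fun h : R => h^-1 *: (pos_sqr (h *: 1 + y) - pos_sqr y)) @ 0^' -->
    2 * Num.max 0 y.
  apply/cvgrPdist_le => e e0; near=> h.
  have h0 : h != 0 by near: h; exact: nbhs_dnbhs_neq.
  have he : `|h| <= e.
    by near: h; apply: dnbhs0_le.
  apply: le_trans he.
  rewrite /GRing.scale /= mulr1.
  (* The first-order Taylor remainder of [pos_sqr] at [y] is at most h^2 in absolute value, whatever
     the signs of [y] and [h + y]. The difference quotient is therefore within |h| of its limit. *)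
  rewrite (_ : _ - _ = h^-1 * (h * (2 * Num.max 0 y) - (pos_sqr (h + y) - pos_sqr y)));
    last by rewrite [RHS]mulrBr mulKf.
  rewrite normrM normfV ler_pdivrMl ?normr_gt0// -normrM.
  rewrite [leRHS]ger0_norm; last by rewrite -expr2 sqr_ge0.
  rewrite /pos_sqr ler_norml; apply/andP; split.
    case: (leP 0 y) => y0; case: (leP 0 (h + y)) => hy; nra.
  case: (leP 0 y) => y0; case: (leP 0 (h + y)) => hy; nra.
split.
  by apply/cvg_ex; exists (2 * Num.max 0 y).
by apply/cvg_lim => //; exact: key.
Unshelve. all: by end_near. Qed.

Lemma continuous_max0 : continuous (fun y : R => Num.max 0 y).
Proof. by move=> y; apply: continuous_max; [exact: cst_continuous|exact: cvg_id]. Qed.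

(** A C^1 step from 0 (for y <= 0) to 1 (for y >= 1). Between them it is 1 - (1 - y^2)^2, whose
    derivative 4y(1 - y^2) vanishes at both ends. *)
Definition smoothstep y : R := 1 - pos_sqr (1 - pos_sqr y).

Definition dsmoothstep y : R :=
  2 * Num.max 0 (1 - pos_sqr y) * (2 * Num.max 0 y).

Lemma is_derive_smoothstep y : is_derive y 1 smoothstep (dsmoothstep y).
Proof.
have d1 : is_derive y 1 (fun t => 1 - pos_sqr t) (- (2 * Num.max 0 y)).
  have H := is_deriveB (is_derive_cst (1 : R) y 1) (is_derive_pos_sqr y).
  by apply: is_derive_eq; rewrite sub0r.
have d2 := @is_derive1_comp _ pos_sqr (fun t => 1 - pos_sqr t) y _ _ (is_derive_pos_sqr (1 - pos_sqr y)) d1.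
have H := is_deriveB (is_derive_cst (1 : R) y 1) d2.
by apply: is_derive_eq; rewrite sub0r /dsmoothstep /GRing.scale /=; ring.
Qed.

Lemma continuous_pos_sqr : continuous pos_sqr.
Proof.
move=> y; apply: differentiable_continuous; apply/derivable1_diffP.
by have [] := is_derive_pos_sqr y.
Qed.

Lemma continuous_dsmoothstep : continuous dsmoothstep.
Proof.
have cm := continuous_max0; have cs := continuous_pos_sqr.
have Cst (k : R) := @cst_continuous R R k.
have c1 : continuous (fun y : R => Num.max 0 (1 - pos_sqr y)).
  move=> y; apply: (@continuous_comp _ _ _ (fun y => 1 - pos_sqr y) (Num.max 0)); last exact: cm.
  by apply: cvgB; [exact: cvg_cst|exact: cs].
move=> y; apply: (@continuousM _ _ (fun y => 2 * Num.max 0 (1 - pos_sqr y)) (fun y => 2 * Num.max 0 y)).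
  by apply: (@continuousM _ _ (cst 2) (fun y => Num.max 0 (1 - pos_sqr y))); [exact: Cst|exact: c1].
by apply: cvgM; [exact: cvg_cst|exact: cm].
Qed.

Lemma pos_sqr_ge0 y : 0 <= pos_sqr y. Proof. exact: sqr_ge0. Qed.

Lemma smoothstep_le0 y : y <= 0 -> smoothstep y = 0.
Proof.
move=> y0; rewrite /smoothstep /pos_sqr (max_idPl y0) expr0n /= subr0.
by rewrite (max_idPr _)// expr1n subrr.
Qed.

Lemma smoothstep_ge1 y : 1 <= y -> smoothstep y = 1.
Proof.
move=> y1; rewrite /smoothstep {1}/pos_sqr (max_idPl _) ?expr0n ?subr0//.
rewrite /pos_sqr (max_idPr _) ?(le_trans ler01)//; nra.
Qed.

Lemma smoothstep_norm y : `|smoothstep y| <= 1.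
Proof.
have := pos_sqr_ge0 y; rewrite /smoothstep; set t := pos_sqr y => t0.
rewrite /pos_sqr; case: (leP 0 (1 - t)) => ht; rewrite ler_norml; nra.
Qed.

(** For a < b the product (x - a)(b - x) is positive exactly on ]a, b[. Multiplying it by [n] makes
    the bump eventually 1 at each point of the box; subtracting 1 keeps the support at a positive
    distance from the sides. *)
Definition bump a b c d (n : nat) (p : R * R) : R :=
  smoothstep (n%:R * ((p.1 - a) * (b - p.1)) - 1) *
  smoothstep (n%:R * ((p.2 - c) * (d - p.2)) - 1).

Lemma C1_bump a b c d n : C1 (bump a b c d n).
Proof.
have Cst (k : R) := C1_cst k.
apply: (@C1M _ (fun p => smoothstep (n%:R * ((p.1 - a) * (b - p.1)) - 1))
               (fun p => smoothstep (n%:R * ((p.2 - c) * (d - p.2)) - 1))).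
- apply: (C1_comp is_derive_smoothstep continuous_dsmoothstep
    (F := fun p => n%:R * ((p.1 - a) * (b - p.1)) - 1)).
  apply: (C1B _ (Cst 1)); apply: C1Z.
  by apply: C1M; [exact: (C1B C1_fst (Cst a))|exact: (C1B (Cst b) C1_fst)].
- apply: (C1_comp is_derive_smoothstep continuous_dsmoothstep
    (F := fun p => n%:R * ((p.2 - c) * (d - p.2)) - 1)).
  apply: (C1B _ (Cst 1)); apply: C1Z.
  by apply: C1M; [exact: (C1B C1_snd (Cst c))|exact: (C1B (Cst d) C1_snd)].
Qed.

Lemma bump_norm a b c d n p : `|bump a b c d n p| <= 1.
Proof. by rewrite normrM mulr_ile1// smoothstep_norm. Qed.

Lemma mul_itv_gt0 a b x : a < b -> 0 < (x - a) * (b - x) -> a < x < b.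
Proof. move=> ab; nra. Qed.

Lemma bump_support a b c d n : a < b -> c < d ->
  compact (supp (bump a b c d n)) /\
  supp (bump a b c d n) `<=` [set p | a < p.1 < b /\ c < p.2 < d].
Proof.
move=> ab cd.
pose u (p : R * R) := n%:R * ((p.1 - a) * (b - p.1)) : R.
pose v (p : R * R) := n%:R * ((p.2 - c) * (d - p.2)) : R.
have Cst (k : R) := C1_cst k.
have cu : continuous u.
  apply: C1_continuous; apply: C1Z.
  by apply: C1M; [exact: (C1B C1_fst (Cst a))|exact: (C1B (Cst b) C1_fst)].
have cv : continuous v.
  apply: C1_continuous; apply: C1Z.
  by apply: C1M; [exact: (C1B C1_snd (Cst c))|exact: (C1B (Cst d) C1_snd)].
(* Where [u] or [v] is below 1 the corresponding step is 0, so the bump lives on the closed set [K];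
   there both products are positive, which places [K] inside the open box. *)
pose K := (u @^-1` [set y | 1 <= y]) `&` (v @^-1` [set y | 1 <= y]).
have clK : closed K.
  by apply: closedI; apply: closed_comp => //; exact: closed_ge.
have sK : supp (bump a b c d n) `<=` K.
  rewrite [X in _ `<=` X](_ : K = closure K); last exact/closure_id.
  apply: closureS => p /= /negP pn0.
  split; rewrite /= leNgt; apply/negP => h; apply: pn0; rewrite /bump -/(u p) -/(v p).
    by rewrite smoothstep_le0 ?mul0r// subr_le0 ltW.
  by rewrite [X in _ * X]smoothstep_le0 ?mulr0// subr_le0 ltW.
have nK (t : R) : 1 <= n%:R * t -> 0 < t.
  by move=> h; rewrite ltNge; apply/negP => t0; have := ler0n R n; nra.
have KB : K `<=` [set p | a < p.1 < b /\ c < p.2 < d].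
  by move=> p [/= /nK h1 /nK h2]; split; exact: mul_itv_gt0.
split; last exact: subset_trans sK KB.
apply: (@subclosed_compact _ _ (`[a, b]%classic `*` `[c, d]%classic)).
- exact: closed_closure.
- by apply: compact_setX; exact: segment_compact.
- by move=> p /sK/KB[p1 p2]; split; rewrite /= in_itv /=; lra.
Qed.

Lemma bump_out a b c d n p : ~ (a < p.1 < b /\ c < p.2 < d) -> a < b -> c < d ->
  bump a b c d n p = 0.
Proof.
move=> pN ab cd; apply/eqP; apply: contrapT => /negP h.
by apply: pN; have [_] := bump_support n ab cd; apply; exact: subset_closure.
Qed.

Lemma bump_near1 a b c d p : a < p.1 < b -> c < p.2 < d ->
  \forall n \near \oo, bump a b c d n p = 1.
Proof.
move=> /andP[ap pb] /andP[cp pd].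
have N1 t : 0 < t -> \forall n \near \oo, 1 <= n%:R * t - 1 :> R.
  (* The threshold 2 / t brings the argument n t - 1 up to 1, where [smoothstep] becomes
     constant. *)
  move=> t0; have := nbhs_infty_ger (2 / t); apply: filterS => n /=.
  by rewrite ler_pdivrMr// => h; lra.
near=> n; rewrite /bump !smoothstep_ge1 ?mulr1//; near: n; apply: N1;
  by rewrite mulr_gt0 ?subr_gt0.
Unshelve. all: by end_near. Qed.

End BumpFunctions.


(** * Functions whose integrals over all open boxes vanish *)

Section PlaneGenerator.
Context {R : realType}.
Notation MR := (measurableTypeR R).

(** The bounds are not ordered: with empty boxes included, the family is stable under
    intersection. *)
Definition open_boxes : set (set (MR * MR)) :=
  [set A | exists a b c d : R, A = `]a, b[%classic `*` `]c, d[%classic].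

Lemma setI_closed_open_boxes : setI_closed open_boxes.
Proof.
move=> _ _ [a [b [c [d ->]]]] [a' [b' [c' [d' ->]]]].
exists (Num.max a a'), (Num.min b b'), (Num.max c c'), (Num.min d d').
apply/seteqP; split => -[x z] /=; rewrite !in_itv /= !gt_max !lt_min.
  by move=> [[/andP[-> ->] /andP[-> ->]] [/andP[-> ->] /andP[-> ->]]].
by move=> [/andP[/andP[-> ->] /andP[-> ->]] /andP[/andP[-> ->] /andP[-> ->]]].
Qed.

Lemma bigcup_sym_itvoo : \bigcup_n `](- n%:R : R), n%:R[%classic = setT.
Proof.
apply/seteqP; split => // x _.
exists (Num.bound `|x|) => //=; rewrite in_itv /= -ltr_norml.
exact: archi_boundP.
Qed.

(** The sets [A] whose cylinder is generated by the boxes form a sigma-algebra. It contains the open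
    intervals, because a strip is the union of its boxes of height ]-n, n[. *)
Lemma open_boxesX1 (A : set MR) : measurable A ->
  <<s open_boxes >> (A `*` setT : set (MR * MR)).
Proof.
have [s0 sC sU] := @smallest_sigma_algebra _ (setT : set (MR * MR)) open_boxes.
suff H : (@measurable _ MR) `<=` [set A | <<s open_boxes >> (A `*` setT : set (MR * MR))].
  by move=> /H.
have -> : @measurable _ MR = <<s measurable_realfun.RGenOpens.G (R := R) >>.
  exact: measurable_realfun.RGenOpens.measurableE.
apply: smallest_sub.
  split => /=.
  - by rewrite set0X.
  - move=> B /sC; congr (<<s _ >> _).
    by apply/seteqP; split => -[x z] /=; tauto.
  - move=> F HF; rewrite (_ : _ `*` _ = \bigcup_n (F n `*` setT)); first exact: sU.
    by rewrite setX_bigcupl.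
move=> _ [x [y ->]] /=.
rewrite -bigcup_sym_itvoo setX_bigcupr; apply: sU => n.
by apply: sub_sigma_algebra; do 4 eexists.
Qed.

Lemma open_boxesX2 (A : set MR) : measurable A ->
  <<s open_boxes >> (setT `*` A : set (MR * MR)).
Proof.
have [s0 sC sU] := @smallest_sigma_algebra _ (setT : set (MR * MR)) open_boxes.
suff H : (@measurable _ MR) `<=` [set A | <<s open_boxes >> (setT `*` A : set (MR * MR))].
  by move=> /H.
have -> : @measurable _ MR = <<s measurable_realfun.RGenOpens.G (R := R) >>.
  exact: measurable_realfun.RGenOpens.measurableE.
apply: smallest_sub.
  split => /=.
  - by rewrite setX0.
  - move=> B /sC; congr (<<s _ >> _).
    by apply/seteqP; split => -[x z] /=; tauto.
  - move=> F HF; rewrite (_ : _ `*` _ = \bigcup_n (setT `*` F n)); first exact: sU.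
    by rewrite setX_bigcupr.
move=> _ [x [y ->]] /=.
rewrite -bigcup_sym_itvoo setX_bigcupl; apply: sU => n.
by apply: sub_sigma_algebra; do 4 eexists.
Qed.

Lemma measurable_open_boxes : @measurable _ (MR * MR)%type = <<s open_boxes >>.
Proof.
apply/seteqP; split; last first.
  apply: smallest_sub; first exact: sigma_algebra_measurable.
  move=> _ [a [b [c [d ->]]]]; apply: measurableX; exact: measurable_itv.
apply: smallest_sub; first exact: smallest_sigma_algebra.
move=> _ [[A mA <-]|[A mA <-]]; rewrite setTI.
  by have := open_boxesX1 mA; congr (<<s _ >> _); rewrite setXT.
by have := open_boxesX2 mA; congr (<<s _ >> _); rewrite setTX.
Qed.

Lemma leb2_aeS (P Q : R * R -> Prop) : (forall p, P p -> Q p) ->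
  {ae leb2 R, forall p, P p} -> {ae leb2 R, forall p, Q p}.
Proof. by move=> PQ; exact: (@filterS _ _ (ae_filter_ringOfSetsType (leb2 R))). Qed.

Lemma leb2_aeS2 (P Q S : R * R -> Prop) : (forall p, P p -> Q p -> S p) ->
  {ae leb2 R, forall p, P p} -> {ae leb2 R, forall p, Q p} ->
  {ae leb2 R, forall p, S p}.
Proof. by move=> PQ; exact: (@filterS2 _ _ (ae_filter_ringOfSetsType (leb2 R))). Qed.

(** Dynkin's argument for the signed measure of density [w]: it vanishes on a generating family
    stable under intersection. The zero integral over the plane is what handles complements. *)
Lemma integral_open_boxes_eq0 (w : R * R -> R) :
  (leb2 R).-integrable setT (EFin \o w) ->
  (\int[leb2 R]_p (w p)%:E = 0)%E ->
  (forall A, open_boxes A -> (\int[leb2 R]_(p in A) (w p)%:E = 0)%E) ->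
  {ae leb2 R, forall p, w p = 0}.
Proof.
move=> wi w0 wG; pose nu := induced_charge wi.
have nu0 (A : set (MR * MR)) : measurable A -> nu A = 0%E.
  move=> mA; apply: (dynkin_induction (P := fun A => nu A = 0%E) measurable_open_boxes setI_closed_open_boxes) => //.
  - move=> S mS S0.
    have E : nu (setT `\` S) = (nu setT - nu S)%E.
      by have := @chargeD _ _ _ nu setT S measurableT mS; rewrite setTI.
    by rewrite -setTD E S0 (w0 : nu setT = 0%E) sube0.
  - move=> F mF tF F0.
    have := @charge_semi_sigma_additive _ _ _ nu F mF tF (bigcupT_measurable _ mF).
    rewrite (_ : (fun n => _) = fun=> 0%E).
      by move=> H; symmetry; exact: (cvg_unique (@ereal_hausdorff R) (cvg_cst 0%E) H).
    by apply/funext => n; rewrite big1.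
  - by rewrite -measurable_open_boxes.
have : ae_eq (leb2 R) setT (EFin \o w) (cst 0%E).
  apply: integral_ae_eq => // E _ mE.
  by rewrite integral0 -[RHS](nu0 E mE).
by apply: leb2_aeS => p /(_ I) [].
Qed.

End PlaneGenerator.

(** * Fundamental lemma of the calculus of variations *)

Section FundamentalLemma.
Context {R : realType}.
Notation MR := (measurableTypeR R).
Variables (L T : R).
Hypotheses (L0 : 0 < L) (T0 : 0 < T).
Notation Om := (rect L T : set (MR * MR)).
Notation intg F := ((leb2 R).-integrable Om (EFin \o F)).
Variable w : R * R -> R.
Hypothesis wi : intg w.
Hypothesis w0 : forall phi, test_function Om phi ->
  \int[leb2 R]_(p in Om) (w p * phi p) = 0.

Let mOm := measurable_rect L T.

(** The bumps of the box are test functions, bounded by 1, and converge pointwise to its indicator;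
    dominated convergence, with |w| as bound, passes to the limit in the hypothesis [w0]. *)
Lemma integral_box_eq0 (a b c d : R) : a < b -> c < d ->
  - (L / 2) <= a -> b <= L / 2 -> 0 <= c -> d <= T ->
  (\int[leb2 R]_(p in `]a, b[%classic `*` `]c, d[%classic) (w p)%:E = 0)%E.
Proof.
move=> ab cd La bL c0 dT; set B := _ `*` _.
have mB : measurable (B : set (MR * MR)) by apply: measurableX; exact: measurable_itv.
have BOm : B `<=` Om by move=> p [] /=; rewrite !in_itv /= => p1 p2; split; lra.
have mw := measurable_integrable wi.
pose F n p : \bar R := (w p * bump a b c d n p)%:E.
have mF n : measurable_fun Om (F n).
  apply/measurable_EFinP; apply: measurable_funM => //.
  exact: (continuous_measurable_plane mOm (C1_continuous (C1_bump a b c d n))).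
have test n : test_function Om (bump a b c d n).
  have [cs sB] := bump_support n ab cd.
  split; [exact: C1_bump|exact: cs|].
  by apply: (subset_trans sB) => p [p1 p2]; split; lra.
have F0 n : (\int[leb2 R]_(p in Om) F n p = 0)%E.
  have FI : intg (fun p => w p * bump a b c d n p).
    apply: (integrable_mulr_bounded mOm wi _ (fun p _ => bump_norm a b c d n p)).
    exact: (continuous_measurable_plane mOm (C1_continuous (C1_bump a b c d n))).
  by rewrite -[LHS]fineK ?integrable_fin_num//; congr EFin; exact: w0.
have mB1 : measurable_fun Om (fun p => w p * \1_B p).
  by apply: measurable_funM => //; exact: measurable_indic.
have DC : [/\ (leb2 R).-integrable Om (fun p => (w p * \1_B p)%:E),
   (fun n => \int[leb2 R]_(p in Om) `|F n p - (w p * \1_B p)%:E|)%E @ \oo --> 0%E &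
   (fun n => \int[leb2 R]_(p in Om) F n p)%E @ \oo -->
     (\int[leb2 R]_(p in Om) (w p * \1_B p)%:E)%E].
  apply: (dominated_convergence mOm (g := fun p => `|(w p)%:E|%E)) => //.
  - exact/measurable_EFinP.
  - apply/aeW => p Omp; have [pB|pB] := pselect (B p).
      have [pB1 pB2] := pB; rewrite /= !in_itv /= in pB1 pB2.
      apply: cvg_near_cst; have := bump_near1 pB1 pB2; apply: filterS => n.
      by rewrite /F indicE mem_set// => ->.
    apply: cvg_near_cst; apply: nearW => n; rewrite /F bump_out//.
    by rewrite indicE memNset.
  - exact: integrable_abse.
  - apply/aeW => p n _; rewrite lee_fin normrM ler_piMr//.
    exact: bump_norm.
have [_ _] := DC; under eq_fun do rewrite F0.
move=> H; have := cvg_unique (@ereal_hausdorff R) (cvg_cst 0%E) H => E.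
rewrite [RHS]E [in LHS](_ : B = Om `&` B); last first.
  by apply/seteqP; split=> p; [move=> Bp; split => //; exact: BOm|case].
rewrite integral_mkcondr.
apply: eq_integral => p _; rewrite patchE indicE.
by case: ifPn => pB; rewrite ?mulr1 ?mulr0.
Qed.

Lemma integral_test_functions_eq0 : {ae leb2 R, forall p, Om p -> w p = 0}.
Proof.
pose w' : R * R -> R := w \_ Om.
have E A : (\int[leb2 R]_(p in A) (w' p)%:E = \int[leb2 R]_(p in A `&` Om) (w p)%:E)%E.
  by rewrite integral_mkcondr; apply: eq_integral => p _; rewrite /w' !patchE; case: ifP.
have w'i : (leb2 R).-integrable setT (EFin \o w').
  rewrite /w' -restrict_EFin; apply/integrable_restrict => //.
  by rewrite setTI.
have box0 A : open_boxes A -> (\int[leb2 R]_(p in A) (w' p)%:E = 0)%E.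
  move=> [a [b [c [d ->]]]]; rewrite E.
  (* Extending [w] by zero turns an arbitrary box into its intersection with the rectangle, which is
     again a box, possibly empty. *)
  rewrite (_ : _ `&` _ = `]Num.max a (- (L / 2)), Num.min b (L / 2)[%classic `*`
       `]Num.max c 0, Num.min d T[%classic); last first.
    apply/seteqP; split => -[x z]; rewrite /rect /= !in_itv /= !gt_max !lt_min.
      by move=> [[/andP[-> ->] /andP[-> ->]] [/andP[-> ->] /andP[-> ->]]].
    by move=> [/andP[/andP[-> ->] /andP[-> ->]] /andP[/andP[-> ->] /andP[-> ->]]].
  have [xy|yx] := ltP (Num.max a (- (L / 2))) (Num.min b (L / 2)); last first.
    by rewrite [X in X `*` _]set_itv_ge ?bnd_simp -?leNgt// set0X integral_set0.
  have [zt|tz] := ltP (Num.max c 0) (Num.min d T); last first.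
    by rewrite [X in _ `*` X]set_itv_ge ?bnd_simp -?leNgt// setX0 integral_set0.
  by apply: integral_box_eq0 => //; rewrite ?le_max ?ge_min ?lexx ?orbT.
have w'0 : (\int[leb2 R]_p (w' p)%:E = 0)%E.
  rewrite E setTI rectE; apply: integral_box_eq0 => //.
  by have := L0; lra.
have := integral_open_boxes_eq0 w'i w'0 box0.
by apply: leb2_aeS => p + Omp; rewrite /w' patchE mem_set.
Qed.


End FundamentalLemma.

Lemma derive_x_fst (R : realType) (q : R * R) : 'D_dirx (fst : R * R -> R) q = 1.
Proof. exact: (congr1 (@^~ q) (derive_fst dirx)). Qed.

Lemma derive_x_fst_shift (R : realType) (c : R) :
  'D_dirx (fst \- cst c : R * R -> R) = cst 1.
Proof.
apply/funext => q.
transitivity ('D_dirx (fst : R * R -> R) q - 'D_dirx (cst c : R * R -> R) q).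
  by apply: deriveB; [exact: C1_derivable C1_fst|exact: derivable_cst].
by rewrite derive_cst subr0; exact: derive_x_fst.
Qed.

Lemma cvg0_lin (R : realType) (A B : R) (s t : nat -> R) :
  s n @[n --> \oo] --> (0 : R) -> t n @[n --> \oo] --> (0 : R) ->
  (A * s n + B * t n) @[n --> \oo] --> (0 : R).
Proof.
move=> s0 t0; rewrite [X in _ --> X](_ : 0 = A * 0 + B * 0); last by rewrite !mulr0 addr0.
by apply: cvgD; apply: cvgM => //; exact: cvg_cst.
Qed.

Lemma limr_ge_cst (R : realType) (s : nat -> R) (x l : R) :
  s n @[n --> \oo] --> l -> (forall n, x <= s n) -> x <= l.
Proof.
move=> sl xs; rewrite -(cvg_lim (@Rhausdorff R) sl); apply: limr_ge.
  by apply/cvg_ex; exists l.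
by apply: nearW.
Qed.

Lemma sqr_subr_half_le (R : realType) (L x : R) :
  - (L / 2) < x < L / 2 -> (x - L / 2) ^+ 2 <= L ^+ 2.
Proof.
move=> xL; have : 0 <= (L - (x - L / 2)) * (L + (x - L / 2)).
  by apply: mulr_ge0; lra.
by lra.
Qed.

(* Keeps conversion from comparing the two axes by unfolding real numbers. *)
#[local] Opaque dirx dirz.

(** * Weak derivatives and their linearity *)

Section WeakDerivatives.
Context {R : realType}.
Notation MR := (measurableTypeR R).
Variables (L T : R).
Hypotheses (L0 : 0 < L) (T0 : 0 < T).
Notation Om := (rect L T : set (MR * MR)).
Notation intg F := ((leb2 R).-integrable Om (EFin \o F)).
Notation int F := (\int[leb2 R]_(p in Om) F p).
Implicit Types (a b : R) (f g u : R * R -> R) (e : R * R).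

Let mOm := measurable_rect L T.
Let fOm := leb2_rect_fin L0 T0.

(** One form for sums, differences and midpoints, so that each quadratic functional needs a single
    expansion lemma. *)
Definition lin a f b g : R * R -> R := fun p => a * f p + b * g p.

(** [C1] and [H1] provide continuous, respectively weak, derivatives along these two directions. *)
Definition axis e : Prop := e = dirx \/ e = dirz.

Lemma L2_integrable f : L2 Om f -> intg f.
Proof. by move=> [mf f2]; exact: sqr_integrable_integrable. Qed.

Lemma L2_lin a f b g : L2 Om f -> L2 Om g -> L2 Om (lin a f b g).
Proof.
move=> [mf f2] [mg g2]; split.
  by apply: measurable_funD; apply: measurable_funM.
by apply: sqr_integrableD => //; rewrite ?sqr_integrableZ//; apply: measurable_funM.
Qed.

Lemma L2_continuous f : continuous f -> L2 Om f.
Proof.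
move=> cf; split; first exact: continuous_measurable_plane.
apply: (continuous_integrable L0 T0 (F := fun p => f p ^+ 2)) => p.
apply: (@continuous_comp _ _ _ f (fun y => y ^+ 2)); first exact: cf.
exact: exprn_continuous.
Qed.

Lemma L2_integrable_mul f g : L2 Om f -> L2 Om g -> intg (fun p => f p * g p).
Proof. by move=> [mf f2] [mg g2]; exact: integrable_mul. Qed.

Lemma int_lin a f b g : intg f -> intg g ->
  int (lin a f b g) = a * int f + b * int g.
Proof.
move=> fi gi.
by rewrite /lin RintegralD ?RintegralZl//; exact: integrable_realZ.
Qed.

Lemma int_sqr_lin a f b g : L2 Om f -> L2 Om g ->
  int (fun p => lin a f b g p ^+ 2) =
  a ^+ 2 * int (fun p => f p ^+ 2) + 2 * a * b * int (fun p => f p * g p) +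
  b ^+ 2 * int (fun p => g p ^+ 2).
Proof.
move=> Lf Lg; have fg := L2_integrable_mul Lf Lg.
case: Lf Lg => [mf f2] [mg g2].
rewrite -!RintegralZl// -!RintegralD//.
- by apply: eq_Rintegral => p _; rewrite /lin; ring.
- by apply: (integrable_realD mOm); exact: integrable_realZ.
- exact: integrable_realZ.
- exact: integrable_realZ.
- exact: integrable_realZ.
Qed.

Lemma test_function_derive e phi : axis e -> test_function Om phi ->
  L2 Om ('D_e phi).
Proof.
by move=> He [[_ cx cz] _ _]; case: He => ->; [exact: L2_continuous cx|exact: L2_continuous cz].
Qed.

Lemma test_function_L2 phi : test_function Om phi -> L2 Om phi.
Proof. by move=> [Cphi _ _]; apply: L2_continuous; exact: C1_continuous. Qed.

Lemma is_weak_deriv_lin e a f f' b g g' : axis e -> L2 Om f -> L2 Om g ->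
  is_weak_deriv Om e f f' -> is_weak_deriv Om e g g' ->
  is_weak_deriv Om e (lin a f b g) (lin a f' b g').
Proof.
move=> He Lf Lg [Lf' ff'] [Lg' gg']; split; first exact: L2_lin.
move=> phi tphi.
have Ld := test_function_derive He tphi.
have Lp := test_function_L2 tphi.
transitivity (int (lin a (fun p => f p * 'D_e phi p) b (fun p => g p * 'D_e phi p))).
  by apply: eq_Rintegral => p _; rewrite /lin; ring.
rewrite int_lin; [|exact: L2_integrable_mul..].
rewrite ff'// gg'// !mulrN -opprD -int_lin; [|exact: L2_integrable_mul..].
by congr -%R; apply: eq_Rintegral => p _; rewrite /lin; ring.
Qed.

Lemma is_weak_deriv_unique e f g g' :
  is_weak_deriv Om e f g -> is_weak_deriv Om e f g' ->
  {ae leb2 R, forall p, Om p -> g p = g' p}.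
Proof.
move=> [Lg fg] [Lg' fg'].
suff : {ae leb2 R, forall p, Om p -> lin 1 g (-1) g' p = 0}.
  by apply: leb2_aeS => p + Omp => /(_ Omp); rewrite /lin => h; lra.
apply: integral_test_functions_eq0 => //.
  by apply: L2_integrable; exact: L2_lin.
move=> phi tphi; have Lp := test_function_L2 tphi.
transitivity (int (lin 1 (fun p => g p * phi p) (-1) (fun p => g' p * phi p))).
  by apply: eq_Rintegral => p _; rewrite /lin; ring.
rewrite int_lin; [|exact: L2_integrable_mul..].
by have := fg _ tphi; rewrite (fg' _ tphi) => /eqP; rewrite eqr_opp => /eqP ->; lra.
Qed.

(** The existence clauses of [H1] exclude the default value of [xget]. *)
Lemma H1_wderiv e f : axis e -> H1 Om f -> is_weak_deriv Om e f (wderiv Om e f).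
Proof.
move=> He [_ [gx Hx] [gz Hz]].
by case: He => ->; rewrite /wderiv; apply: (@xgetPex _ (cst 0) [set g | is_weak_deriv Om _ f g]);
  [exists gx|exists gz].
Qed.

Lemma H1_L2 f : H1 Om f -> L2 Om f. Proof. by case. Qed.

Lemma H1_wderiv_L2 e f : axis e -> H1 Om f -> L2 Om (wderiv Om e f).
Proof. by move=> He Hf; have [] := H1_wderiv He Hf. Qed.

Lemma axis_x : axis dirx. Proof. by left. Qed.
Lemma axis_z : axis dirz. Proof. by right. Qed.

Lemma H1_lin a f b g : H1 Om f -> H1 Om g -> H1 Om (lin a f b g).
Proof.
move=> Hf Hg; have Lf := H1_L2 Hf; have Lg := H1_L2 Hg; split.
- exact: L2_lin.
- by eexists; apply: is_weak_deriv_lin => //; [exact: axis_x|exact: (H1_wderiv axis_x)..].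
- by eexists; apply: is_weak_deriv_lin => //; [exact: axis_z|exact: (H1_wderiv axis_z)..].
Qed.

(** Both sides are weak derivatives of the same function, hence agree almost everywhere; the choice
    made by [wderiv] allows no pointwise equality. *)
Lemma wderiv_lin e a f b g : axis e -> H1 Om f -> H1 Om g ->
  {ae leb2 R, forall p, Om p ->
    wderiv Om e (lin a f b g) p = lin a (wderiv Om e f) b (wderiv Om e g) p}.
Proof.
move=> He Hf Hg; apply: (@is_weak_deriv_unique e (lin a f b g)).
  by apply: H1_wderiv => //; exact: H1_lin.
by apply: is_weak_deriv_lin => //; [exact: H1_L2|exact: H1_L2|exact: H1_wderiv..].
Qed.

(** * Energy, L^2 norm and H^1 norm as quadratic forms *)

Definition energy f : R := int (gradsq Om f).

Definition wdot e f g : R := int (fun p => wderiv Om e f p * wderiv Om e g p).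

(** Polar form of [energy]: the cross term of its expansion. *)
Definition energy2 f g : R := wdot dirx f g + wdot dirz f g.

Lemma energyE f : H1 Om f -> energy f = energy2 f f.
Proof.
move=> Hf; rewrite /energy /gradsq RintegralD//.
- by have [] := H1_wderiv_L2 axis_x Hf.
- by have [] := H1_wderiv_L2 axis_z Hf.
Qed.

Lemma wdot_lin e a f b g : axis e -> H1 Om f -> H1 Om g ->
  wdot e (lin a f b g) (lin a f b g) =
  a ^+ 2 * wdot e f f + 2 * a * b * wdot e f g + b ^+ 2 * wdot e g g.
Proof.
move=> He Hf Hg; rewrite -[RHS](int_sqr_lin a b (H1_wderiv_L2 He Hf) (H1_wderiv_L2 He Hg)).
apply: (ae_eq_Rintegral mOm).
- by have [] := H1_wderiv_L2 He (H1_lin a b Hf Hg).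
- by have [] := L2_lin a b (H1_wderiv_L2 He Hf) (H1_wderiv_L2 He Hg).
- by apply: leb2_aeS (wderiv_lin a b He Hf Hg) => p + Omp => /(_ Omp) ->.
Qed.

Lemma wdot_weak_deriv e f g : axis e -> H1 Om f -> is_weak_deriv Om e f g ->
  wdot e f f = int (fun p => g p ^+ 2).
Proof.
move=> He Hf fg; apply: (ae_eq_Rintegral mOm).
- by have [] := H1_wderiv_L2 He Hf.
- by have [[]] := fg.
- by apply: leb2_aeS (is_weak_deriv_unique (H1_wderiv He Hf) fg) => p + Omp => /(_ Omp) ->.
Qed.

Lemma wdot_ge0 e f : 0 <= wdot e f f.
Proof. by apply: Rintegral_ge0 => p _; rewrite -expr2 sqr_ge0. Qed.

#[local] Opaque wdot.

Lemma energy_lin a f b g : H1 Om f -> H1 Om g -> energy (lin a f b g) =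
  a ^+ 2 * energy f + 2 * a * b * energy2 f g + b ^+ 2 * energy g.
Proof.
move=> Hf Hg; rewrite (energyE (H1_lin a b Hf Hg)) (energyE Hf) (energyE Hg).
rewrite /energy2 (wdot_lin a b axis_x Hf Hg) (wdot_lin a b axis_z Hf Hg).
have E (x1 x2 x3 z1 z2 z3 : R) :
    a ^+ 2 * x1 + 2 * a * b * x2 + b ^+ 2 * x3 +
    (a ^+ 2 * z1 + 2 * a * b * z2 + b ^+ 2 * z3) =
    a ^+ 2 * (x1 + z1) + 2 * a * b * (x2 + z2) + b ^+ 2 * (x3 + z3) by ring.
exact: E.
Qed.

Lemma energy_ge0 f : 0 <= energy f.
Proof. by apply: Rintegral_ge0 => p _; rewrite addr_ge0 ?sqr_ge0. Qed.

Definition sqnorm f : R := int (fun p => f p ^+ 2).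

Lemma sqnorm_lin a f b g : L2 Om f -> L2 Om g -> sqnorm (lin a f b g) =
  a ^+ 2 * sqnorm f + 2 * a * b * int (fun p => f p * g p) + b ^+ 2 * sqnorm g.
Proof. exact: int_sqr_lin. Qed.

Lemma sqnormE f : sqnorm f = int (fun p => f p ^+ 2). Proof. by []. Qed.

Lemma sqnorm_ge0 f : 0 <= sqnorm f.
Proof. by apply: Rintegral_ge0 => p _; rewrite sqr_ge0. Qed.

Lemma H1norm_sqr f : H1norm Om f ^+ 2 = sqnorm f + energy f.
Proof.
by apply: sqr_sqrtr; exact: (addr_ge0 (sqnorm_ge0 f) (energy_ge0 f)).
Qed.

Lemma wdot_x_le_energy f : H1 Om f -> wdot dirx f f <= energy f.
Proof. by move=> Hf; rewrite (energyE Hf) /energy2 lerDl; exact: wdot_ge0. Qed.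

#[local] Opaque energy sqnorm energy2.

Lemma H1norm_ge0 f : 0 <= H1norm Om f. Proof. by rewrite /H1norm sqrtr_ge0. Qed.

#[local] Opaque H1norm.

(** A triangle inequality up to a constant, enough for sequences tending to 0. Adding the
    nonnegative values [z] and [w] of the forms at [lin a f (- b) g] cancels the cross terms and
    leaves 2a^2 x^2 + 2b^2 y^2. *)
Lemma H1norm_lin_le a f b g : H1 Om f -> H1 Om g ->
  H1norm Om (lin a f b g) <=
  2 * (`|a| + `|b|) * (H1norm Om f + H1norm Om g).
Proof.
move=> Hf Hg; have Lf := H1_L2 Hf; have Lg := H1_L2 Hg.
have key (x y z w A B sx sxy sy ex exy ey : R) : 0 <= x -> 0 <= y ->
    x ^+ 2 = sx + ex -> y ^+ 2 = sy + ey ->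
    A = a ^+ 2 * sx + 2 * a * b * sxy + b ^+ 2 * sy ->
    B = a ^+ 2 * ex + 2 * a * b * exy + b ^+ 2 * ey ->
    0 <= z -> z = a ^+ 2 * sx + 2 * a * (- b) * sxy + (- b) ^+ 2 * sy ->
    0 <= w -> w = a ^+ 2 * ex + 2 * a * (- b) * exy + (- b) ^+ 2 * ey ->
    A + B <= (2 * (`|a| + `|b|) * (x + y)) ^+ 2.
  move=> x0 y0 qx qy -> -> z0 zE w0 wE.
  apply: (@le_trans _ _ (2 * a ^+ 2 * x ^+ 2 + 2 * b ^+ 2 * y ^+ 2)).
    by rewrite qx qy; lra.
  rewrite -(real_normK (num_real a)) -(real_normK (num_real b)) !exprMn.
  have a0 := normr_ge0 a; have b0 := normr_ge0 b.
  have h1 : `|a| ^+ 2 * x ^+ 2 <= (`|a| + `|b|) ^+ 2 * (x + y) ^+ 2.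
    by apply: ler_pM; rewrite ?sqr_ge0// ler_pXn2r ?nnegrE ?addr_ge0//; lra.
  have h2 : `|b| ^+ 2 * y ^+ 2 <= (`|a| + `|b|) ^+ 2 * (x + y) ^+ 2.
    by apply: ler_pM; rewrite ?sqr_ge0// ler_pXn2r ?nnegrE ?addr_ge0//; lra.
  move: h1 h2; set u := _ * _; set v := _ * _; set t := (_ + _) ^+ 2.
  by set t' := (_ + _) ^+ 2; rewrite -![2 * _ * _]mulrA -/u -/v; lra.
rewrite -(@ler_pXn2r _ 2) ?nnegrE ?H1norm_ge0//; last first.
  by rewrite mulr_ge0 ?addr_ge0 ?mulr_ge0 ?addr_ge0 ?H1norm_ge0.
rewrite H1norm_sqr; apply: (key _ _ (sqnorm (lin a f (- b) g)) (energy (lin a f (- b) g))).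
- exact: H1norm_ge0.
- exact: H1norm_ge0.
- exact: H1norm_sqr.
- exact: H1norm_sqr.
- exact: sqnorm_lin.
- exact: energy_lin.
- exact: sqnorm_ge0.
- exact: sqnorm_lin.
- exact: energy_ge0.
- exact: energy_lin.
Qed.

(** * Functions of class C^1 as elements of H^1 *)

Lemma test_function_out phi p : test_function Om phi -> ~ Om p -> phi p = 0.
Proof.
move=> [_ _ sOm] pOm; apply/eqP; apply: contrapT => /negP h.
by apply: pOm; apply: sOm; exact: subset_closure.
Qed.

(** The sides do not belong to the open rectangle, so both boundary values in the divergence formula
    are 0. *)
Lemma int_derive_eq0 e F : axis e -> C1 F -> (forall p, ~ Om p -> F p = 0) ->
  int ('D_e F) = 0.
Proof.
move=> He CF F0; case: He => ->.
  rewrite (divergence_x L0 T0 CF) (_ : (fun _ => _) = cst 0) ?Rintegral_cst ?mul0r//.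
  by apply/funext => z; rewrite !F0 ?subrr// => -[] /=; lra.
rewrite (divergence_z L0 T0 CF) (_ : (fun _ => _) = cst 0) ?Rintegral_cst ?mul0r//.
by apply/funext => z; rewrite !F0 ?subrr// => -[] /=; lra.
Qed.

Lemma C1_is_weak_deriv e u : axis e -> C1 u -> is_weak_deriv Om e u ('D_e u).
Proof.
move=> He Cu; split.
  by case: Cu => _ cx cz; case: He => ->; [exact: L2_continuous cx|exact: L2_continuous cz].
move=> phi tphi; have [Cphi _ _] := tphi.
have Du : L2 Om ('D_e u).
  by case: Cu => _ cx cz; case: He => ->; [exact: L2_continuous cx|exact: L2_continuous cz].
have Lu : L2 Om u by apply: L2_continuous; exact: C1_continuous.
have Ld := test_function_derive He tphi; have Lp := test_function_L2 tphi.
apply/eqP; rewrite -addr_eq0; apply/eqP.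
rewrite -RintegralD//; [|exact: L2_integrable_mul..].
rewrite -[RHS](@int_derive_eq0 e (u \* phi)) //; last 2 first.
- exact: C1M.
- by move=> p pOm; rewrite /= (test_function_out tphi pOm) mulr0.
by rewrite derive_C1M//; apply: eq_Rintegral => p _ /=; rewrite [X in _ + X]mulrC.
Qed.

Lemma C1_H1 u : C1 u -> H1 Om u.
Proof.
move=> Cu; split.
- by apply: L2_continuous; exact: C1_continuous.
- by exists ('D_dirx u); exact: C1_is_weak_deriv axis_x Cu.
- by exists ('D_dirz u); exact: C1_is_weak_deriv axis_z Cu.
Qed.

(** * Poincare inequality with a boundary term *)

Lemma continuous_integrable_itv (h : R -> R) a b : continuous h ->
  (leb1 R).-integrable `]a, b[ (EFin \o h).
Proof.
move=> ch; apply: (@integrableS _ _ _ (leb1 R) `[a, b]%classic) => //.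
  exact: subset_itv_oo_cc.
apply: continuous_compact_integrable; first exact: segment_compact.
exact: continuous_subspaceT.
Qed.

Lemma continuous_sqr (X : topologicalType) (h : X -> R) :
  continuous h -> continuous (fun x => h x ^+ 2).
Proof.
move=> ch x; apply: (@continuous_comp _ _ _ h (fun y => y ^+ 2)); first exact: ch.
exact: exprn_continuous.
Qed.

(** Here [x] is the value of the function, [y] its x-derivative and [t] the weight. Expanding (x + 2
    t y)^2 >= 0 absorbs the mixed term at the price of half of x^2. *)
Let poincare_pointwise (t x y : R) : t ^+ 2 <= L ^+ 2 ->
  2^-1 * x ^+ 2 - 2 * L ^+ 2 * y ^+ 2 <= 2 * t * (x * y) + x ^+ 2.
Proof.
move=> h; have := sqr_ge0 (x + 2 * t * y).
have : t ^+ 2 * y ^+ 2 <= L ^+ 2 * y ^+ 2 by rewrite ler_wpM2r ?sqr_ge0.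
by lra.
Qed.

Let poincare_integrated (w E S t : R) : w <= E ->
  2^-1 * S - 2 * L ^+ 2 * w <= L * t -> S <= 2 * L * t + 4 * L ^+ 2 * E.
Proof.
move=> wE h; have : L ^+ 2 * w <= L ^+ 2 * E by rewrite ler_wpM2l ?sqr_ge0.
by lra.
Qed.

(** The weight x - L/2 is 0 on the right side and -L on the left one, so only the left boundary
    values survive, with factor L. *)
Lemma C1_poincare u : C1 u ->
  sqnorm u <= 2 * L * \int[leb1 R]_(z in `]0, T[) (u (- (L / 2), z) ^+ 2) +
              4 * L ^+ 2 * energy u.
Proof.
move=> Cu; have cu := C1_continuous Cu.
have Lu := L2_continuous cu; have [_ cxu _] := Cu; have LDu := L2_continuous cxu.
pose F := (fst \- cst (L / 2)) \* (u \* u) : R * R -> R.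
have Cf : C1 (fst \- cst (L / 2) : R * R -> R) by apply: C1B; [exact: C1_fst|exact: C1_cst].
have CF : C1 F by exact: C1M Cf (C1M Cu Cu).
have dF : 'D_dirx F = (fun p => 2 * (p.1 - L / 2) * (u p * 'D_dirx u p) + u p ^+ 2).
  rewrite /F (derive_C1M dirx Cf (C1M Cu Cu)) (derive_C1M dirx Cu Cu).
  rewrite derive_x_fst_shift.
  by apply/funext => p /=; ring.
have div := divergence_x L0 T0 CF.
have ci : (leb1 R).-integrable `]0, T[ (EFin \o (fun z => u (- (L / 2), z) ^+ 2)).
  apply: continuous_integrable_itv; apply: continuous_sqr => z.
  apply: (@continuous_comp _ _ _ (fun z => (- (L / 2), z)) u); last exact: cu.
  exact: continuous_pairr.
have rhs : \int[leb1 R]_(z in `]0, T[) (F (L / 2, z) - F (- (L / 2), z)) =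
           L * \int[leb1 R]_(z in `]0, T[) (u (- (L / 2), z) ^+ 2).
  rewrite -RintegralZl //.
  by apply: eq_Rintegral => z _; rewrite /F /=; field.
have lhs : 2^-1 * sqnorm u - 2 * L ^+ 2 * wdot dirx u u <= int ('D_dirx F).
  rewrite (wdot_weak_deriv axis_x (C1_H1 Cu) (C1_is_weak_deriv axis_x Cu)) sqnormE.
  have i1 := Lu.2; have i2 := LDu.2.
  rewrite -!RintegralZl// -RintegralB//; [|exact: integrable_realZ..].
  apply: le_Rintegral => //.
  - by apply: (integrable_realB mOm); exact: integrable_realZ.
  - by have [_ cD _] := CF; exact: continuous_integrable.
  move=> p [/andP[p1 p2] _]; have -> := congr1 (@^~ p) dF.
  have h := sqr_subr_half_le (introT andP (conj p1 p2)).
  exact: poincare_pointwise h.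
have ene : wdot dirx u u <= energy u.
  by apply: wdot_x_le_energy; exact: C1_H1.
rewrite div rhs in lhs.
exact: poincare_integrated ene lhs.
Qed.

(** * Zero traces and the Poincare inequality *)

(** Makes the boundary integrals real: they are finite because each [u n] is continuous along
    [gamma], itself continuous on a bounded interval. *)
Lemma zero_traceP (gamma : R -> R * R) c d f : continuous gamma ->
  has_trace Om gamma `]c, d[ f (cst 0) <->
  exists u : nat -> R * R -> R,
    [/\ forall n, C1 (u n), H1norm Om (lin 1 (u n) (-1) f) @[n --> \oo] --> (0 : R)
      & \int[leb1 R]_(t in `]c, d[) (u n (gamma t) ^+ 2) @[n --> \oo] --> (0 : R)].
Proof.
move=> cg.
have E1 u : u \- f = lin 1 u (-1) f.
  by apply/funext => p; rewrite /lin /= mul1r mulN1r.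
have E2 u : C1 u -> (\int[leb1 R]_(t in `]c, d[) ((u (gamma t) - cst 0 t) ^+ 2)%:E =
   (\int[leb1 R]_(t in `]c, d[) (u (gamma t) ^+ 2))%:E)%E.
  move=> Cu; rewrite -integral_EFin_Rintegral//.
    by apply: eq_integral => t _; rewrite subr0.
  apply: continuous_integrable_itv; apply: continuous_sqr => t.
  by apply: (@continuous_comp _ _ _ gamma u); [exact: cg|exact: C1_continuous].
split=> -[u [Cu nu tu]]; exists u; (split; first exact: Cu).
- rewrite (_ : (fun n => _) = (fun n => H1norm Om (u n \- f))); first exact: nu.
  by apply/funext => n; rewrite E1.
- rewrite (_ : (fun n => _) = fine \o (fun n =>
      \int[leb1 R]_(t in `]c, d[) ((u n (gamma t) - cst 0 t) ^+ 2)%:E)%E).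
    exact: fine_cvg tu.
  by apply/funext => n /=; rewrite E2.
- rewrite (_ : (fun n => _) = (fun n => H1norm Om (lin 1 (u n) (-1) f))); first exact: nu.
  by apply/funext => n; rewrite E1.
- rewrite (_ : (fun n => _) = (fun n => (\int[leb1 R]_(t in `]c, d[) (u n (gamma t) ^+ 2))%:E)).
    by apply: cvg_EFin; [exact: nearW|exact: tu].
  by apply/funext => n; rewrite E2.
Qed.

Lemma C1_lin a f b g : C1 f -> C1 g -> C1 (lin a f b g).
Proof. by move=> Cf Cg; apply: C1D; exact: C1Z. Qed.

Lemma has_trace_lin (gamma : R -> R * R) c d a f b g : continuous gamma ->
  H1 Om f -> H1 Om g ->
  has_trace Om gamma `]c, d[ f (cst 0) -> has_trace Om gamma `]c, d[ g (cst 0) ->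
  has_trace Om gamma `]c, d[ (lin a f b g) (cst 0).
Proof.
move=> cg Hf Hg /(zero_traceP _ _ _ cg)[u [Cu nu tu]] /(zero_traceP _ _ _ cg)[v [Cv nv tv]].
apply/(zero_traceP _ _ _ cg); exists (fun n => lin a (u n) b (v n)); split.
- by move=> n; exact: C1_lin.
- have E n : lin 1 (lin a (u n) b (v n)) (-1) (lin a f b g) =
             lin a (lin 1 (u n) (-1) f) b (lin 1 (v n) (-1) g).
    by apply/funext => p; rewrite /lin; ring.
  apply: (@squeeze_cvgr _ _ _ _ (cst 0) (fun n =>
    2 * (`|a| + `|b|) * H1norm Om (lin 1 (u n) (-1) f) +
    2 * (`|a| + `|b|) * H1norm Om (lin 1 (v n) (-1) g))).
  + apply: nearW => n; rewrite H1norm_ge0 /= E -mulrDr.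
    have H1u := H1_lin 1 (-1) (C1_H1 (Cu n)) Hf.
    have H1v := H1_lin 1 (-1) (C1_H1 (Cv n)) Hg.
    exact: (H1norm_lin_le a b H1u H1v).
  + exact: cvg_cst.
  + exact: (cvg0_lin _ _ nu nv).
- apply: (@squeeze_cvgr _ _ _ _ (cst 0) (fun n =>
    2 * a ^+ 2 * \int[leb1 R]_(t in `]c, d[) (u n (gamma t) ^+ 2) +
    2 * b ^+ 2 * \int[leb1 R]_(t in `]c, d[) (v n (gamma t) ^+ 2))).
  + have ci w : C1 w -> (leb1 R).-integrable `]c, d[ (EFin \o (fun t => w (gamma t) ^+ 2)).
      move=> Cw; apply: continuous_integrable_itv; apply: continuous_sqr => t.
      by apply: (@continuous_comp _ _ _ gamma w); [exact: cg|exact: C1_continuous].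
    apply: nearW => n; apply/andP; split.
      by apply: Rintegral_ge0 => t _; rewrite sqr_ge0.
    have iu := ci _ (Cu n); have iv := ci _ (Cv n).
    rewrite -!RintegralZl// -RintegralD//; [|exact: integrable_realZ..].
    apply: le_Rintegral => //.
    - exact: (ci _ (C1_lin a b (Cu n) (Cv n))).
    - by apply: integrable_realD => //; exact: integrable_realZ.
    - by move=> t _; rewrite /lin; have := sqr_ge0 (a * u n (gamma t) - b * v n (gamma t)); lra.
  + exact: cvg_cst.
  + exact: (cvg0_lin _ _ tu tv).
Qed.

(** The letters s and e stand for [sqnorm] and [energy], the suffix uf for cross terms, [tn] for the
    boundary integral and [sn] for the H^1 norm of u - f. Nonnegativity of the energy of u/2 - f
    gives e(u) <= 2 e(f) + 2 e(u - f); that of the square norm of u - f/2 gives s(f) <= 2 s(u) + 2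
    s(u - f). The constant 16 is 2 * 4 * 2. *)
Let poincare_arith (su eu suf euf sf ef tn sn : R) :
  su <= 2 * L * tn + 4 * L ^+ 2 * eu ->
  0 <= 1 ^+ 2 * eu + 2 * 1 * (-1) * euf + (-1) ^+ 2 * ef ->
  0 <= 1 ^+ 2 * su + 2 * 1 * (-1) * suf + (-1) ^+ 2 * sf ->
  0 <= 1 ^+ 2 * su + 2 * 1 * (- 2^-1) * suf + (- 2^-1) ^+ 2 * sf ->
  0 <= 2^-1 ^+ 2 * eu + 2 * 2^-1 * (-1) * euf + (-1) ^+ 2 * ef ->
  sn ^+ 2 = (1 ^+ 2 * su + 2 * 1 * (-1) * suf + (-1) ^+ 2 * sf) +
            (1 ^+ 2 * eu + 2 * 1 * (-1) * euf + (-1) ^+ 2 * ef) ->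
  sf - 16 * L ^+ 2 * ef <= 4 * L * tn + (16 * L ^+ 2 + 2) * (sn * sn).
Proof.
move=> P ed sd s2 e2 sE.
set De := 1 ^+ 2 * eu + _ + _ in ed sE; set Ds := 1 ^+ 2 * su + _ + _ in sd sE.
have heu : eu <= 2 * ef + 2 * De by rewrite /De; lra.
have hsf : sf <= 2 * su + 2 * Ds by rewrite /Ds; lra.
have hL : L ^+ 2 * eu <= L ^+ 2 * (2 * ef + 2 * De) by rewrite ler_wpM2l ?sqr_ge0.
have hD : 0 <= L ^+ 2 * Ds by rewrite mulr_ge0 ?sqr_ge0.
move: sE; rewrite expr2 => ->; move: De Ds ed sd heu hsf hL hD => De Ds *; lra.
Qed.

Lemma poincare f : H1 Om f ->
  has_trace Om (fun z => (- (L / 2), z)) `]0, T[ f (cst 0) ->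
  sqnorm f <= 16 * L ^+ 2 * energy f.
Proof.
move=> Hf /zero_traceP[|u [Cu nu tu]]; first exact: continuous_pairr.
pose t n := \int[leb1 R]_(z in `]0, T[) (u n (- (L / 2), z) ^+ 2).
pose s n := H1norm Om (lin 1 (u n) (-1) f).
have ss0 : s n * s n @[n --> \oo] --> (0 : R).
  by rewrite [X in _ --> X](_ : 0 = 0 * 0 :> R); [exact: (cvgM nu nu)|rewrite mulr0].
have cB := cvg0_lin (4 * L) (16 * L ^+ 2 + 2) tu ss0.
(* The left side does not depend on [n], so it suffices to bound it by each term of the null
   sequence [cB]. *)
rewrite -subr_le0; apply: (limr_ge_cst cB) => n.
have Hu := C1_H1 (Cu n); have Lf := H1_L2 Hf; have Lu := H1_L2 Hu.
have := H1norm_sqr (lin 1 (u n) (-1) f); rewrite -/(s n).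
have := energy_ge0 (lin 2^-1 (u n) (-1) f); rewrite (energy_lin _ _ Hu Hf).
have := sqnorm_ge0 (lin 1 (u n) (-2^-1) f); rewrite (sqnorm_lin _ _ Lu Lf).
have := sqnorm_ge0 (lin 1 (u n) (-1) f); rewrite (sqnorm_lin _ _ Lu Lf).
have := energy_ge0 (lin 1 (u n) (-1) f); rewrite (energy_lin _ _ Hu Hf).
have := C1_poincare (Cu n); rewrite -/(t n).
exact: poincare_arith.
Qed.

End WeakDerivatives.

(** * Bounds on the oscillating kernel *)

Section Kernel.
Context {R : realType}.
Notation MR := (measurableTypeR R).

(* The shared properties of [cos] and [sin] used on the oscillating factor. *)
Definition lipschitz1_bounded1 (h : R -> R) : Prop :=
  (forall x, `|h x| <= 1) /\ (forall x y, `|h x - h y| <= `|x - y|).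

Lemma derive_le1_lipschitz (h dh : R -> R) :
  (forall x : R, is_derive x 1 h (dh x)) -> (forall x, `|dh x| <= 1) ->
  forall x y, `|h x - h y| <= `|x - y|.
Proof.
move=> hd dh1.
have ch x : {for x, continuous h}.
  by apply: differentiable_continuous; apply/derivable1_diffP; have [] := hd x.
have W x y : x <= y -> `|h x - h y| <= `|x - y|.
  move=> xy.
  have [z _ hz] := MVT_segment xy (fun t _ => hd t) (continuous_subspaceT ch).
  by rewrite distrC [leRHS]distrC hz normrM ler_piMl.
move=> x y; have [xy|/ltW yx] := leP x y; first exact: W.
by rewrite distrC [leRHS]distrC; exact: W.
Qed.

Lemma lipschitz1_bounded1_cos : lipschitz1_bounded1 cos.
Proof.
split=> [x|]; first by rewrite ler_norml cos_geN1 cos_le1.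
apply: (@derive_le1_lipschitz cos (fun x => - sin x)).
by move=> x; rewrite normrN ler_norml sin_geN1 sin_le1.
Qed.

Lemma lipschitz1_bounded1_sin : lipschitz1_bounded1 sin.
Proof.
split=> [x|]; first by rewrite ler_norml sin_geN1 sin_le1.
apply: (@derive_le1_lipschitz sin cos).
by move=> x; rewrite ler_norml cos_geN1 cos_le1.
Qed.

(** For x <= y the difference is e^(-x) (1 - e^(x - y)); the first factor is at most 1 since x >= 0,
    the second at most y - x since e^t >= 1 + t. *)
Lemma lipschitz_expRN (a b : R) : 0 <= a -> 0 <= b ->
  `|expR (- a) - expR (- b)| <= `|a - b|.
Proof.
have W (x y : R) : 0 <= x -> x <= y -> `|expR (- x) - expR (- y)| <= `|x - y|.
  move=> x0 xy; have e1 : expR (- x) <= 1 by rewrite expR_le1 oppr_le0.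
  have e0 := expR_gt0 (- x).
  have := expR_ge1Dx (x - y).
  have -> : expR (- y) = expR (- x) * expR (x - y) by rewrite -expRD; congr expR; ring.
  have f1 : expR (x - y) <= 1 by rewrite expR_le1 subr_le0.
  move: (expR (- x)) (expR (x - y)) e1 e0 f1 => s t e1 e0 f1 h.
  rewrite [leRHS]distrC (ger0_norm (_ : 0 <= y - x)) ?subr_ge0// ger0_norm; first nra.
  by rewrite subr_ge0 ler_piMr// ltW.
move=> a0 b0; have [ab|/ltW ba] := leP a b; first exact: W.
by rewrite distrC [leRHS]distrC; exact: W.
Qed.

(** With [h] equal to [cos] or [sin], the real or imaginary part of the complex kernel of [Tf]. *)
Definition ker (h : R -> R) (v lam : R) (p : R * R) : R :=
  expR (- (lam ^+ 2 * v * p.2)) * h (- (lam * v * p.1)).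

Lemma lipschitz1_continuous h : lipschitz1_bounded1 h -> continuous h.
Proof.
move=> [_ hl] x; apply/cvgrPdist_le => e e0.
near=> t; apply: le_trans (hl x t) _.
near: t; exact: cvgr_dist_le.
Unshelve. all: by end_near. Qed.

Lemma continuous_ker h v lam : continuous h -> continuous (ker h v lam).
Proof.
move=> ch.
have cu : continuous (fun p : R * R => - (lam ^+ 2 * v * p.2)).
  rewrite (_ : (fun _ => _) = (fun p => - (lam ^+ 2 * v) * p.2)).
    by apply: C1_continuous; apply: C1Z; exact: C1_snd.
  by apply/funext => p; rewrite mulNr.
have cw : continuous (fun p : R * R => - (lam * v * p.1)).
  rewrite (_ : (fun _ => _) = (fun p => - (lam * v) * p.1)).
    by apply: C1_continuous; apply: C1Z; exact: C1_fst.
  by apply/funext => p; rewrite mulNr.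
move=> p; apply: (@continuousM _ _ (fun p => expR (- (lam ^+ 2 * v * p.2)))
  (fun p => h (- (lam * v * p.1)))).
  by apply: (@continuous_comp _ _ _ _ expR); [exact: cu|exact: continuous_expR].
by apply: (@continuous_comp _ _ _ _ h); [exact: cw|exact: ch].
Qed.

Let damping_ge0 (lam v z : R) : 0 <= v -> 0 <= z -> 0 <= lam ^+ 2 * v * z.
Proof. by move=> v0 z0; do 2 apply: mulr_ge0 => //; exact: sqr_ge0. Qed.

Lemma ker_norm h v lam p : lipschitz1_bounded1 h -> 0 <= v -> 0 <= p.2 ->
  `|ker h v lam p| <= 1.
Proof.
move=> [h1 _] v0 p0; rewrite /ker normrM mulr_ile1//.
by rewrite ger0_norm ?expR_ge0// expR_le1 oppr_le0 damping_ge0.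
Qed.

(** Speed and frequency vary together: the case lam = lam' gives the Lipschitz bound in v, the case
    v = v' continuity in lam. *)
Lemma ker_lipschitz h v lam v' lam' p : lipschitz1_bounded1 h ->
  0 <= v -> 0 <= v' -> 0 <= p.2 ->
  `|ker h v lam p - ker h v' lam' p| <=
  `|lam ^+ 2 * v - lam' ^+ 2 * v'| * p.2 + `|lam * v - lam' * v'| * `|p.1|.
Proof.
move=> [h1 hl] v0 v'0 p0; rewrite /ker.
set a := lam ^+ 2 * v * p.2; set b := lam' ^+ 2 * v' * p.2.
set s := lam * v * p.1; set t := lam' * v' * p.1.
have a0 : 0 <= a by exact: damping_ge0.
have b0 : 0 <= b by exact: damping_ge0.
have -> : `|lam ^+ 2 * v - lam' ^+ 2 * v'| * p.2 = `|a - b|.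
  by rewrite /a /b -mulrBl normrM (ger0_norm p0).
have -> : `|lam * v - lam' * v'| * `|p.1| = `|(- s) - (- t)|.
  by rewrite -normrM mulrBl distrC; congr `|_|; rewrite /s /t; ring.
have -> : expR (- a) * h (- s) - expR (- b) * h (- t) =
  (expR (- a) - expR (- b)) * h (- s) + expR (- b) * (h (- s) - h (- t)) by ring.
apply: (le_trans (ler_normD _ _)); rewrite !normrM; apply: lerD.
  apply: le_trans (lipschitz_expRN a0 b0); rewrite ler_piMr//.
apply: le_trans (hl _ _); rewrite ler_piMl//.
by rewrite ger0_norm ?expR_ge0// expR_le1 oppr_le0.
Qed.

End Kernel.

Lemma Rintegral_comb3 d (X : measurableType d) (R : realType)
    (mu : {measure set X -> \bar R}) (D : set X) (mD : measurable D)
    (a b c : R) (f g h : X -> R) :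
  mu.-integrable D (EFin \o f) -> mu.-integrable D (EFin \o g) ->
  mu.-integrable D (EFin \o h) ->
  \int[mu]_(x in D) (a * f x + b * g x + c * h x) =
  a * \int[mu]_(x in D) f x + b * \int[mu]_(x in D) g x + c * \int[mu]_(x in D) h x.
Proof.
move=> fi gi hi; rewrite !RintegralD ?RintegralZl//; try exact: integrable_realZ.
by apply: (integrable_realD mD); exact: integrable_realZ.
Qed.

(** * Coefficients of the wave resistance *)

Section WaveResistanceForm.
Context {R : realType}.
Notation MR := (measurableTypeR R).
Variables (L T : R).
Hypotheses (L0 : 0 < L) (T0 : 0 < T).
Notation Om := (rect L T : set (MR * MR)).
Notation intg F := ((leb2 R).-integrable Om (EFin \o F)).
Notation int F := (\int[leb2 R]_(p in Om) F p).
Implicit Types (h : R -> R) (f g : R * R -> R).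

Let mOm := measurable_rect L T.
Let fOm := leb2_rect_fin L0 T0.

Definition ker_coef h f v lam : R :=
  int (fun p => wderiv Om dirx f p * ker h v lam p).

Definition wderiv_L1 f : R := int (fun p => `|wderiv Om dirx f p|).

Let Lw f : H1 Om f -> L2 Om (wderiv Om dirx f).
Proof. by move=> Hf; exact: (H1_wderiv_L2 axis_x Hf). Qed.

Let iw f : H1 Om f -> intg (wderiv Om dirx f).
Proof. by move=> Hf; apply: (L2_integrable L0 T0); exact: Lw. Qed.

Let ia f : H1 Om f -> intg (fun p => `|wderiv Om dirx f p|).
Proof. by move=> Hf; exact: (integrable_norm (iw Hf)). Qed.

Let mker h v lam : lipschitz1_bounded1 h -> measurable_fun Om (ker h v lam).
Proof.
move=> hh; apply: continuous_measurable_plane => //.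
by apply: continuous_ker; exact: lipschitz1_continuous.
Qed.

Lemma integrable_wderiv_ker h f v lam : lipschitz1_bounded1 h -> 0 <= v -> H1 Om f ->
  intg (fun p => wderiv Om dirx f p * ker h v lam p).
Proof.
move=> hh v0 Hf; apply: (integrable_mulr_bounded mOm (M := 1) (iw Hf)).
  exact: mker.
by move=> p [_ /andP[/ltW p0 _]]; exact: ker_norm.
Qed.

Lemma wderiv_L1_ge0 f : 0 <= wderiv_L1 f.
Proof. exact: Rintegral_ge0. Qed.

(** Pointwise |t| <= 1 + t^2, and L T is the area of the rectangle. *)
Lemma wderiv_L1_le f : H1 Om f -> wderiv_L1 f <= L * T + energy L T f.
Proof.
move=> Hf; apply: (@le_trans _ _ (L * T + wdot L T dirx f f)); last first.
  by rewrite lerD2l; exact: wdot_x_le_energy.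
rewrite (wdot_weak_deriv L0 T0 axis_x Hf (H1_wderiv axis_x Hf)).
have -> : L * T = int (fun=> 1) by rewrite Rintegral_cst// mul1r [X in fine X](leb2_rect L0 T0).
have [_ i2] := Lw Hf.
rewrite -RintegralD//; last exact: (integrable_cst mOm fOm 1).
apply: le_Rintegral => //; first exact: ia.
  by apply: (integrable_realD mOm) => //; exact: (integrable_cst mOm fOm 1).
move=> p _; rewrite -(real_normK (num_real (wderiv _ _ _ _))).
by move: (`|_|) => t; have := sqr_ge0 (t - 2^-1); lra.
Qed.

Lemma ker_coef_norm h f v lam : lipschitz1_bounded1 h -> 0 <= v -> H1 Om f ->
  `|ker_coef h f v lam| <= wderiv_L1 f.
Proof.
move=> hh v0 Hf; apply: (Rintegral_le_abs mOm).
- exact: integrable_wderiv_ker.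
- exact: ia.
- move=> p [_ /andP[/ltW p0 _]]; rewrite normrM ler_piMr//.
  exact: ker_norm.
Qed.

Lemma ker_coef_lipschitz h f v lam v' lam' : lipschitz1_bounded1 h ->
  0 <= v -> 0 <= v' -> H1 Om f ->
  `|ker_coef h f v lam - ker_coef h f v' lam'| <=
  wderiv_L1 f * (`|lam ^+ 2 * v - lam' ^+ 2 * v'| * T +
                 `|lam * v - lam' * v'| * (L / 2)).
Proof.
move=> hh v0 v'0 Hf.
have i1 := integrable_wderiv_ker lam hh v0 Hf.
have i2 := integrable_wderiv_ker lam' hh v'0 Hf.
rewrite /ker_coef -RintegralB// /wderiv_L1 -RintegralZr//; last exact: ia.
apply: (Rintegral_le_abs mOm).
- exact: integrable_realB.
- set k := (_ + _); under [X in (leb2 R).-integrable Om X]eq_fun do rewrite /= mulrC.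
  by apply: (integrable_realZ mOm); exact: ia.
- move=> p [/andP[p1 p1'] /andP[/ltW p0 /ltW pT]].
  rewrite -mulrBr normrM ler_wpM2l//.
  apply: (le_trans (ker_lipschitz _ _ hh v0 v'0 p0)); apply: lerD.
    by rewrite ler_wpM2l.
  by rewrite ler_wpM2l// ler_norml; apply/andP; split; apply: ltW.
Qed.

Lemma ker_coef_lin h a f b g v lam : lipschitz1_bounded1 h -> 0 <= v ->
  H1 Om f -> H1 Om g ->
  ker_coef h (lin a f b g) v lam = a * ker_coef h f v lam + b * ker_coef h g v lam.
Proof.
move=> hh v0 Hf Hg.
have i1 := integrable_wderiv_ker lam hh v0 Hf.
have i2 := integrable_wderiv_ker lam hh v0 Hg.
rewrite /ker_coef -!RintegralZl// -RintegralD//; [|exact: integrable_realZ..].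
apply: (ae_eq_Rintegral mOm).
- exact: (integrable_wderiv_ker lam hh v0 (H1_lin L0 T0 a b Hf Hg)).
- by apply: (integrable_realD mOm); exact: integrable_realZ.
- apply: leb2_aeS (wderiv_lin L0 T0 a b axis_x Hf Hg) => p + Omp => /(_ Omp) ->.
  by rewrite /lin; ring.
Qed.

(** Continuity in lam supplies the measurability required to integrate against [mu]. *)
Lemma continuous_ker_coef h f v : lipschitz1_bounded1 h -> 0 <= v -> H1 Om f ->
  continuous (ker_coef h f v).
Proof.
move=> hh v0 Hf lam0.
pose B lam := wderiv_L1 f * (`|lam0 ^+ 2 * v - lam ^+ 2 * v| * T +
                 `|lam0 * v - lam * v| * (L / 2)).
have cB : B lam @[lam --> lam0] --> (0 : R).
  have -> : 0 = wderiv_L1 f * (`|lam0 ^+ 2 * v - lam0 ^+ 2 * v| * T +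
                 `|lam0 * v - lam0 * v| * (L / 2)) by rewrite !subrr normr0 !mul0r addr0 mulr0.
  apply: cvgM; first exact: cvg_cst.
  apply: cvgD; apply: cvgM; [|exact: cvg_cst| |exact: cvg_cst];
    apply: cvg_norm; apply: cvgB; try exact: cvg_cst; apply: cvgM; try exact: cvg_cst.
    exact: exprn_continuous.
  exact: cvg_id.
apply/cvgrPdist_le => e e0.
near=> lam; apply: le_trans (ker_coef_lipschitz lam0 lam hh v0 v0 Hf) _.
rewrite -/(B lam); near: lam.
have /cvgrPdist_le/(_ e e0) := cB; apply: filterS => lam.
by rewrite sub0r normrN; apply: le_trans; exact: ler_norm.
Unshelve. all: by end_near. Qed.

End WaveResistanceForm.

(** * The wave resistance as a quadratic form, Lipschitz in v *)

Section WaveResistanceQuadratic.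
Context {R : realType}.
Notation MR := (measurableTypeR R).
Variables (L T rho grav Lam : R) (mu : {finite_measure set MR -> \bar R}).
Hypotheses (L0 : 0 < L) (T0 : 0 < T) (rho0 : 0 < rho) (grav0 : 0 < grav)
  (Lam1 : 1 < Lam).
Notation Om := (rect L T : set (MR * MR)).
Notation I := (`[1, Lam]%classic : set MR).
Implicit Types (h : R -> R) (f g : R * R -> R).

Let mI : measurable I. Proof. exact: measurable_itv. Qed.

Let muI : (mu I < +oo)%E.
Proof. by rewrite ltey_eq fin_num_measure. Qed.

Definition mass : R := fine (mu I).

Lemma mass_ge0 : 0 <= mass. Proof. exact: fine_ge0. Qed.

Definition coef_form h v f g : R :=
  \int[mu]_(lam in I) (ker_coef L T h f v lam * ker_coef L T h g v lam).

Lemma integrable_coef_form h v f g : lipschitz1_bounded1 h -> 0 <= v ->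
  H1 Om f -> H1 Om g ->
  mu.-integrable I (EFin \o (fun lam => ker_coef L T h f v lam * ker_coef L T h g v lam)).
Proof.
move=> hh v0 Hf Hg.
have mc k : H1 Om k -> measurable_fun I (ker_coef L T h k v).
  move=> Hk; apply: measurable_funTS; apply: continuous_measurable_fun.
  exact: continuous_ker_coef.
apply: (le_integrable_real mI _ (integrable_cst mI muI (wderiv_L1 L T f * wderiv_L1 L T g))).
  by apply: measurable_funM; exact: mc.
by move=> lam _; rewrite normrM ler_pM//; exact: ker_coef_norm.
Qed.

Lemma coef_form_lin h v a f b g : lipschitz1_bounded1 h -> 0 <= v ->
  H1 Om f -> H1 Om g ->
  coef_form h v (lin a f b g) (lin a f b g) =
  a ^+ 2 * coef_form h v f f + 2 * a * b * coef_form h v f g + b ^+ 2 * coef_form h v g g.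
Proof.
move=> hh v0 Hf Hg.
have iff := integrable_coef_form hh v0 Hf Hf.
have ifg := integrable_coef_form hh v0 Hf Hg.
have igg := integrable_coef_form hh v0 Hg Hg.
rewrite -[RHS](Rintegral_comb3 mI _ _ _ iff ifg igg).
apply: eq_Rintegral => lam _; rewrite (ker_coef_lin L0 T0 a b lam hh v0 Hf Hg).
by move: (ker_coef _ _ _ f _ _) (ker_coef _ _ _ g _ _) => x y; ring.
Qed.

Lemma coef_form_ge0 h v f : 0 <= coef_form h v f f.
Proof. by apply: Rintegral_ge0 => lam _; rewrite -expr2 sqr_ge0. Qed.

Lemma coef_form_le h v f : lipschitz1_bounded1 h -> 0 <= v -> H1 Om f ->
  coef_form h v f f <= wderiv_L1 L T f ^+ 2 * mass.
Proof.
move=> hh v0 Hf; rewrite -Rintegral_cst//; apply: le_Rintegral => //.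
- exact: integrable_coef_form.
- exact: (integrable_cst mI muI).
- move=> lam _; apply: le_trans (ler_norm _) _; rewrite normrM expr2.
  by apply: ler_pM => //; exact: ker_coef_norm.
Qed.

Lemma coef_form_lipschitz h v v' f : lipschitz1_bounded1 h -> 0 <= v -> 0 <= v' ->
  H1 Om f ->
  `|coef_form h v f f - coef_form h v' f f| <=
  2 * wderiv_L1 L T f ^+ 2 * (Lam ^+ 2 * T + Lam * (L / 2)) * mass * `|v - v'|.
Proof.
move=> hh v0 v'0 Hf.
have i1 := integrable_coef_form hh v0 Hf Hf.
have i2 := integrable_coef_form hh v'0 Hf Hf.
rewrite -RintegralB// mulrAC -Rintegral_cst//.
apply: (Rintegral_le_abs mI).
- exact: integrable_realB.
- exact: (integrable_cst mI muI).
- move=> lam; rewrite /= in_itv /= => /andP[lam1 lamL].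
  have c1 := ker_coef_norm L0 T0 lam hh v0 Hf.
  have c2 := ker_coef_norm L0 T0 lam hh v'0 Hf.
  have cl := ker_coef_lipschitz L0 T0 lam lam hh v0 v'0 Hf.
  have nE1 : `|lam ^+ 2 * (v - v')| = `|lam ^+ 2| * `|v - v'| := normrM _ _.
  have nE2 : `|lam * (v - v')| = `|lam| * `|v - v'| := normrM _ _.
  rewrite -!mulrBr nE1 nE2 in cl.
  have M0 := wderiv_L1_ge0 L T f.
  move: (ker_coef _ _ _ _ _ _) (ker_coef _ _ _ _ v' _) (wderiv_L1 _ _ _) c1 c2 cl M0.
  move=> x y M c1 c2 cl M0.
  (* As lam <= [Lam], this makes the bound independent of lam, ready to be integrated as a
     constant. *)
  have kl : `|lam ^+ 2| * `|v - v'| * T + `|lam| * `|v - v'| * (L / 2) <=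
            (Lam ^+ 2 * T + Lam * (L / 2)) * `|v - v'|.
    have l0 : 0 <= lam by apply: le_trans lam1.
    rewrite (ger0_norm (sqr_ge0 lam)) (ger0_norm l0) mulrDl; apply: lerD.
      rewrite mulrAC ler_wpM2r// ler_wpM2r ?(ltW T0)// ler_pXn2r ?nnegrE//.
      exact: le_trans lamL.
    by rewrite mulrAC ler_wpM2r// ler_wpM2r// divr_ge0 ?(ltW L0).
  (* Both coefficients are at most [M] in absolute value, so the factor x + y costs 2M. *)
  have -> : x * x - y * y = (x + y) * (x - y) by ring.
  rewrite normrM.
  have xy : `|x + y| <= 2 * M by apply: le_trans (ler_normD _ _) _; lra.
  apply: (@le_trans _ _ (2 * M * (M * ((Lam ^+ 2 * T + Lam * (L / 2)) * `|v - v'|)))).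
    apply: ler_pM => //; apply: le_trans cl _.
    by rewrite ler_wpM2l.
  by rewrite le_eqVlt; apply/orP; left; apply/eqP; ring.
Qed.

Lemma RresE v f : 0 <= v -> H1 Om f ->
  Rres L T rho grav Lam mu v f =
  4 * rho * grav * v / pi * (coef_form cos v f f + coef_form sin v f f).
Proof.
move=> v0 Hf; rewrite /Rres; congr (_ * _).
have ic := integrable_coef_form (@lipschitz1_bounded1_cos R) v0 Hf Hf.
have is_ := integrable_coef_form (@lipschitz1_bounded1_sin R) v0 Hf Hf.
rewrite -RintegralD//.
apply: eq_Rintegral => lam _.
rewrite /Tf /cintegral2 /ComplexField.Normc.normc sqr_sqrtr; last first.
  by rewrite addr_ge0 ?sqr_ge0.
rewrite -!expr2; congr (_ ^+ 2 + _ ^+ 2); apply: eq_Rintegral => p _;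
  by rewrite /ker /=; ring.
Qed.

(** Polar form of [Rres]. *)
Definition res_form v f g : R :=
  4 * rho * grav * v / pi * (coef_form cos v f g + coef_form sin v f g).

Lemma Rres_lin v a f b g : 0 <= v -> H1 Om f -> H1 Om g ->
  Rres L T rho grav Lam mu v (lin a f b g) =
  a ^+ 2 * Rres L T rho grav Lam mu v f + 2 * a * b * res_form v f g +
  b ^+ 2 * Rres L T rho grav Lam mu v g.
Proof.
move=> v0 Hf Hg; rewrite (RresE v0 Hf) (RresE v0 Hg) (RresE v0 (H1_lin L0 T0 a b Hf Hg)).
rewrite (coef_form_lin a b lipschitz1_bounded1_cos v0 Hf Hg).
rewrite (coef_form_lin a b lipschitz1_bounded1_sin v0 Hf Hg) /res_form.
set c := _ / pi.
have E (c1 c2 c3 s1 s2 s3 : R) : c * (a ^+ 2 * c1 + 2 * a * b * c2 + b ^+ 2 * c3 +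
    (a ^+ 2 * s1 + 2 * a * b * s2 + b ^+ 2 * s3)) =
  a ^+ 2 * (c * (c1 + s1)) + 2 * a * b * (c * (c2 + s2)) + b ^+ 2 * (c * (c3 + s3)).
  by ring.
exact: E.
Qed.

Let coef_ge0 v : 0 <= v -> 0 <= 4 * rho * grav * v / pi.
Proof.
move=> v0; rewrite divr_ge0 ?pi_ge0// mulr_ge0// mulr_ge0 ?ltW// mulr_gt0//.
Qed.

Lemma Rres_ge0 v f : 0 <= v -> H1 Om f -> 0 <= Rres L T rho grav Lam mu v f.
Proof.
move=> v0 Hf; rewrite (RresE v0 Hf); apply: mulr_ge0; first exact: coef_ge0.
by apply: addr_ge0; exact: coef_form_ge0.
Qed.

(** Lipschitz constant of [Rres] per unit of squared L^1 norm of the x-derivative. The 2 comes from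
    varying the prefactor v, the other term from varying the kernel. *)
Definition Rres_modulus v : R :=
  4 * rho * grav / pi * mass * (2 + 4 * v * (Lam ^+ 2 * T + Lam * (L / 2))).

Lemma Rres_modulus_ge0 v : 0 <= v -> 0 <= Rres_modulus v.
Proof.
move=> v0; have Lam0 := ltW (lt_trans ltr01 Lam1).
rewrite /Rres_modulus mulr_ge0 ?addr_ge0 ?mulr_ge0 ?addr_ge0 ?mulr_ge0
  ?mass_ge0 ?sqr_ge0 ?invr_ge0 ?pi_ge0 ?(ltW rho0) ?(ltW grav0) ?(ltW T0) ?(ltW L0)//.
Qed.

(** [M] is a squared L^1 norm, [m] the mass of [mu]. The product is split so that only w' multiplies
    the variation of the integral: the constant then involves the reference speed alone. *)
Let Rres_arith (c w w' Iv Iw M m k : R) : 0 <= c -> 0 <= w' -> 0 <= Iv ->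
  Iv <= 2 * M * m -> `|Iv - Iw| <= 4 * M * k * m * `|w - w'| ->
  `|c * w * Iv - c * w' * Iw| <= c * m * (2 + 4 * w' * k) * M * `|w - w'|.
Proof.
move=> c0 w0 I0 IM dI.
have -> : c * w * Iv - c * w' * Iw = c * (Iv * (w - w') + w' * (Iv - Iw)) by ring.
have -> : c * m * (2 + 4 * w' * k) * M * `|w - w'| =
  c * (2 * M * m * `|w - w'| + w' * (4 * M * k * m * `|w - w'|)) by ring.
rewrite normrM (ger0_norm c0) ler_wpM2l//.
apply: le_trans (ler_normD _ _) _; rewrite !normrM (ger0_norm I0) (ger0_norm w0).
by apply: lerD; [rewrite ler_wpM2r|rewrite ler_wpM2l].
Qed.

Let add_le_arith1 (x y M m : R) : x <= M * m -> y <= M * m -> x + y <= 2 * M * m.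
Proof. by lra. Qed.

Let add_le_arith2 (x y M k m d : R) : x <= 2 * M * k * m * d ->
  y <= 2 * M * k * m * d -> x + y <= 4 * M * k * m * d.
Proof. by lra. Qed.

Lemma Rres_lipschitz v v' f : 0 <= v -> 0 <= v' -> H1 Om f ->
  `|Rres L T rho grav Lam mu v f - Rres L T rho grav Lam mu v' f| <=
  Rres_modulus v' * wderiv_L1 L T f ^+ 2 * `|v - v'|.
Proof.
move=> v0 v'0 Hf; rewrite (RresE v0 Hf) (RresE v'0 Hf) /Rres_modulus.
have C := @lipschitz1_bounded1_cos R; have S := @lipschitz1_bounded1_sin R.
have c1 := coef_form_le C v0 Hf; have s1 := coef_form_le S v0 Hf.
have c2 := coef_form_lipschitz C v0 v'0 Hf; have s2 := coef_form_lipschitz S v0 v'0 Hf.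
have cs0 := addr_ge0 (coef_form_ge0 cos v f) (coef_form_ge0 sin v f).
rewrite ![4 * rho * grav * _ / pi]mulrAC; apply: Rres_arith => //.
- by have := @coef_ge0 1 ler01; rewrite mulr1.
- exact: add_le_arith1 c1 s1.
- rewrite opprD addrACA; apply: le_trans (ler_normD _ _) _.
  exact: add_le_arith2 c2 s2.
Qed.

End WaveResistanceQuadratic.

#[local] Opaque energy sqnorm H1norm.

(** * Stability of the minimizers *)

Section MinimizerStability.
Context {R : realType}.
Notation MR := (measurableTypeR R).
Variables (L T : R).
Hypotheses (L0 : 0 < L) (T0 : 0 < T).
Notation Om := (rect L T : set (MR * MR)).
Implicit Types (f g : R * R -> R).

Lemma Hspace_lin a f b g : Hspace L T f -> Hspace L T g -> Hspace L T (lin a f b g).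
Proof.
move=> [Hf f1 f2 f3] [Hg g1 g2 g3]; split.
- exact: (H1_lin L0 T0 a b Hf Hg).
- exact: (has_trace_lin L0 T0 a b (@continuous_pairr R (- (L / 2))) Hf Hg f1 g1).
- exact: (has_trace_lin L0 T0 a b (@continuous_pairr R (L / 2)) Hf Hg f2 g2).
- exact: (has_trace_lin L0 T0 a b (@continuous_pairl R T) Hf Hg f3 g3).
Qed.

Lemma CV_midpoint V f g : CV L T V f -> CV L T V g ->
  CV L T V (lin 2^-1 f 2^-1 g).
Proof.
move=> [Hf fV f0] [Hg gV g0]; split; first exact: Hspace_lin.
- have [[Lf _ _] _ _ _] := Hf; have [[Lg _ _] _ _ _] := Hg.
  rewrite (int_lin _ _ (L2_integrable L0 T0 Lf) (L2_integrable L0 T0 Lg)) fV gV.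
  by field.
- apply: leb2_aeS2 f0 g0 => p + + Omp => /(_ Omp) fp /(_ Omp) gp.
  by rewrite /lin addr_ge0 ?mulr_ge0 ?invr_ge0.
Qed.

Lemma H1norm_le_energy f : Hspace L T f ->
  H1norm Om f ^+ 2 <= (16 * L ^+ 2 + 1) * energy L T f.
Proof.
move=> [Hf f1 _ _]; rewrite (H1norm_sqr L T f) mulrDl mul1r lerD2r.
exact: (poincare L0 T0 Hf f1).
Qed.

Variables (V rho grav eps Lam : R) (mu : {finite_measure set MR -> \bar R}).
Hypotheses (rho0 : 0 < rho) (grav0 : 0 < grav) (eps0 : 0 < eps) (Lam1 : 1 < Lam).
Notation N := (Nfun L T rho grav eps Lam mu).
Notation Res := (Rres L T rho grav Lam mu).

Lemma NfunE v f : N v f = Res v f + eps * energy L T f.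
Proof. by []. Qed.

Lemma Nfun_lin v a f b g : 0 <= v -> H1 Om f -> H1 Om g ->
  N v (lin a f b g) = a ^+ 2 * N v f +
    2 * a * b * (res_form L T rho grav Lam mu v f g + eps * energy2 L T f g) +
    b ^+ 2 * N v g.
Proof.
move=> v0 Hf Hg; rewrite !NfunE (energy_lin L0 T0 a b Hf Hg).
rewrite (Rres_lin rho grav Lam mu L0 T0 a b v0 Hf Hg).
have E (x1 x2 x3 y1 y2 y3 : R) :
    a ^+ 2 * x1 + 2 * a * b * x2 + b ^+ 2 * x3 +
    eps * (a ^+ 2 * y1 + 2 * a * b * y2 + b ^+ 2 * y3) =
    a ^+ 2 * (x1 + eps * y1) + 2 * a * b * (x2 + eps * y2) + b ^+ 2 * (x3 + eps * y3).
  by ring.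
exact: E.
Qed.

Let gap_arith (NF Ng N2 ND r e : R) :
  NF <= 2^-1 ^+ 2 * NF + 2 * 2^-1 * 2^-1 * N2 + 2^-1 ^+ 2 * Ng ->
  ND = 1 ^+ 2 * NF + 2 * 1 * (-1) * N2 + (-1) ^+ 2 * Ng ->
  ND = r + e -> 0 <= r -> e <= 2 * (Ng - NF).
Proof. by move=> h1 -> h2 r0; lra. Qed.

(* Parallelogram identity for [N v], using that the midpoint is admissible. *)
Lemma minimizer_gap v f g : 0 <= v -> is_minimizer (CV L T V) (N v) f ->
  CV L T V g -> eps * energy L T (lin 1 f (-1) g) <= 2 * (N v g - N v f).
Proof.
move=> v0 [Cf fmin] Cg; have [[Hf _ _ _] _ _] := Cf; have [[Hg _ _ _] _ _] := Cg.
have mid := fmin _ (CV_midpoint Cf Cg).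
rewrite (Nfun_lin _ _ v0 Hf Hg) in mid.
apply: (gap_arith mid (Nfun_lin 1 (-1) v0 Hf Hg) (NfunE v _)).
by apply: (Rres_ge0 Lam mu L0 T0 rho0 grav0 v0); exact: (H1_lin L0 T0).
Qed.

(** F is the minimizer at v, g the one at b, and d = |v - b|. Minimality at v with d <= 1 bounds A +
    e(F) by [B], a quantity built from g alone. Then [gap] and [minb] leave only the variations of R
    at g and at F, of order K Mg^2 d and K B^2 d. *)
Let stability_arith (K d Rvg Rbg RvF RbF eg eF eD Mg MF A : R) :
  0 <= K -> 0 <= d -> d <= 1 -> 0 <= MF ->
  eps * eD <= 2 * ((Rvg + eps * eg) - (RvF + eps * eF)) ->
  Rbg + eps * eg <= RbF + eps * eF ->
  `|Rvg - Rbg| <= K * Mg ^+ 2 * d -> `|RvF - RbF| <= K * MF ^+ 2 * d ->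
  RvF + eps * eF <= Rvg + eps * eg -> 0 <= RvF -> MF <= A + eF ->
  eD <= 2 * K * (Mg ^+ 2 + (A + (Rbg + K * Mg ^+ 2 + eps * eg) / eps) ^+ 2) / eps * d.
Proof.
move=> K0 d0 d1 MF0 gap minb; rewrite !ler_norml => /andP[g1 g2] /andP[F1 F2] minv R0 MFe.
set B := A + _.
have KM : K * Mg ^+ 2 * d <= K * Mg ^+ 2 by rewrite ler_piMr// mulr_ge0 ?sqr_ge0.
have eFB : A + eF <= B.
  rewrite lerD2l ler_pdivlMr// mulrC; lra.
have MFB : K * MF ^+ 2 * d <= K * B ^+ 2 * d.
  rewrite ler_wpM2r// ler_wpM2l// ler_pXn2r ?nnegrE//.
    exact: le_trans MFe eFB.
  exact: le_trans MF0 (le_trans MFe eFB).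
have -> : 2 * K * (Mg ^+ 2 + B ^+ 2) / eps * d =
          (2 * (K * Mg ^+ 2 * d + K * B ^+ 2 * d)) / eps.
  by field; rewrite gt_eqF.
rewrite ler_pdivlMr// mulrC; move: (K * Mg ^+ 2 * d) (K * B ^+ 2 * d) (K * MF ^+ 2 * d) g1 g2 F1 F2 MFB.
by move=> x y z *; lra.
Qed.

Lemma minimizer_stability v b f g : 0 < v -> 0 < b -> `|v - b| <= 1 ->
  is_minimizer (CV L T V) (N v) f -> is_minimizer (CV L T V) (N b) g ->
  energy L T (lin 1 f (-1) g) <=
    2 * Rres_modulus L T rho grav Lam mu b * (wderiv_L1 L T g ^+ 2 +
      (L * T + (Res b g + Rres_modulus L T rho grav Lam mu b * wderiv_L1 L T g ^+ 2 +
                eps * energy L T g) / eps) ^+ 2) / eps * `|v - b|.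
Proof.
move=> v0 b0 vb1 mf mg; have [Cf fmin] := mf; have [Cg gmin] := mg.
have [[Hf _ _ _] _ _] := Cf; have [[Hg _ _ _] _ _] := Cg.
apply: (@stability_arith _ _ (Res v g) (Res b g) (Res v f) (Res b f) (energy L T g)
  (energy L T f) _ _ (wderiv_L1 L T f)).
- exact: (Rres_modulus_ge0 mu L0 T0 rho0 grav0 Lam1 (ltW b0)).
- exact: normr_ge0.
- exact: vb1.
- exact: wderiv_L1_ge0.
- exact: (minimizer_gap (ltW v0) mf Cg).
- exact: gmin.
- exact: (Rres_lipschitz Lam mu L0 T0 rho0 grav0 (ltW v0) (ltW b0) Hg).
- exact: (Rres_lipschitz Lam mu L0 T0 rho0 grav0 (ltW v0) (ltW b0) Hf).
- exact: fmin.
- exact: (Rres_ge0 Lam mu L0 T0 rho0 grav0 (ltW v0) Hf).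
- exact: (wderiv_L1_le L0 T0 Hf).
Qed.

End MinimizerStability.

Theorem theorem3p6 (R : realType) (L T rho grav V eps Lam : R)
    (hL : 0 < L) (hT : 0 < T) (hrho : 0 < rho) (hgrav : 0 < grav)
    (hV : 0 < V) (heps : 0 < eps) (hLam : 1 < Lam)
    (mu : {finite_measure set (measurableTypeR R) -> \bar R})
    (f : R -> R * R -> R)
    (hf : forall v : R, 0 < v ->
      is_unique_minimizer L T (CV L T V) (Nfun L T rho grav eps Lam mu v) (f v))
    (vbar : R) (hvbar : 0 < vbar) :
  H1norm (rect L T) (f v \- f vbar) @[v --> vbar] --> (0 : R).
Proof.
(* The Poincare factor of [H1norm_le_energy] times the coefficient in [minimizer_stability]; it
   involves [f vbar] but not [f v]. *)
pose C := (16 * L ^+ 2 + 1) * (2 * Rres_modulus L T rho grav Lam mu vbar *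
  (wderiv_L1 L T (f vbar) ^+ 2 + (L * T + (Rres L T rho grav Lam mu vbar (f vbar) +
    Rres_modulus L T rho grav Lam mu vbar * wderiv_L1 L T (f vbar) ^+ 2 +
    eps * energy L T (f vbar)) / eps) ^+ 2) / eps).
have bound v : 0 < v -> `|v - vbar| <= 1 ->
    H1norm (rect L T) (f v \- f vbar) ^+ 2 <= C * `|v - vbar|.
  move=> v0 vb1; have [mv _] := hf v v0; have [mb _] := hf vbar hvbar.
  have -> : f v \- f vbar = lin 1 (f v) (-1) (f vbar).
    by apply/funext => p; rewrite /lin /= mul1r mulN1r.
  have [[Hv _ _] _] := mv; have [[Hb _ _] _] := mb.
  apply: (le_trans (H1norm_le_energy hL hT (Hspace_lin hL hT 1 (-1) Hv Hb))).
  rewrite /C -mulrA ler_wpM2l//; first by rewrite addr_ge0// mulr_ge0// sqr_ge0.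
  exact: (minimizer_stability hL hT hrho hgrav heps hLam v0 hvbar vb1 mv mb).
apply/cvgrPdist_le => e e0.
(* The estimate concerns the squared norm, hence e^2. The denominator |C| + 1 is positive without
   any information on the sign of [C]. *)
have d0 : 0 < e ^+ 2 / (`|C| + 1) by rewrite divr_gt0 ?exprn_gt0// ltr_wpDl.
near=> v.
have v0 : 0 < v by near: v; exact: lt_nbhsr.
have vb1 : `|v - vbar| <= 1.
  by rewrite distrC; near: v; apply: cvgr_dist_le.
have vbd : `|v - vbar| <= e ^+ 2 / (`|C| + 1).
  by rewrite distrC; near: v; apply: cvgr_dist_le.
rewrite sub0r normrN ger0_norm ?H1norm_ge0//.
rewrite -(@ler_pXn2r _ 2) ?nnegrE ?H1norm_ge0 ?(ltW e0)//.
apply: (le_trans (bound v v0 vb1)).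
apply: (@le_trans _ _ ((`|C| + 1) * `|v - vbar|)).
  by rewrite ler_wpM2r// (le_trans (ler_norm _))// lerDl.
by rewrite mulrC -ler_pdivlMr// ltr_wpDl.
Unshelve. all: by end_near. Qed.
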